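(* Let $H=\sum_{\mathbf{j}\in V}h_{\mathbf{j}}$ be a Hamiltonian (setting in the context) whose frustration graph $G=(V,E)$ is claw-free. Then for all token-sliding charges $Q^{(s,\mu)}_G$, $Q^{(t,\nu)}_G$ and all generalized cycle symmetries $J_{\langle C_0\rangle}$, $J_{\langle C_0'\rangle}$ of $G$, \[ \text{(i)}\ [Q^{(s,\mu)}_G,Q^{(t,\nu)}_G]=0,\qquad \text{(ii)}\ [J_{\langle C_0\rangle},Q^{(s,\mu)}_G]=0,\qquad \text{(iii)}\ [J_{\langle C_0\rangle},J_{\langle C_0'\rangle}]=0 . \] In particular (since $\sum_{\mu}Q^{(1,\mu)}_G=H$) these operators are conserved charges of $H$.
   Context: Setting: $V$ is a finite set of distinct $n$-qubit Pauli strings, and $H=\sum_{\mathbf{j}\in V}h_{\mathbf{j}}$ with $h_{\mathbf{j}}=b_{\mathbf{j}}\sigma^{\mathbf{j}}$, $b_{\mathbf{j}}\in\mathbb{R}\setminus\{0\}$; so each $h_{\mathbf{j}}$ is Hermitian, $h_{\mathbf{j}}^2=b_{\mathbf{j}}^2I$, and any two terms commute or anticommute. The frustration graph $G=(V,E)$ has an edge $\{\mathbf{j},\mathbf{k}\}$ iff $h_{\mathbf{j}}h_{\mathbf{k}}=-h_{\mathbf{k}}h_{\mathbf{j}}$. The claw is $K_{1,3}$; $G$ is claw-free if no four vertices induce a claw. For $U\subseteq V$, $h_U$ denotes a product of the $h_{\mathbf{j}}$, $\mathbf{j}\in U$; for an independent set $S$ the order is irrelevant. A hole is an induced cycle of length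 $\ge 4$; an even hole $C$ of length $2k$ has two colour classes $C_a,C_b$ (independent sets of size $k$) and we set $h_C=h_{C_a}h_{C_b}$. Single-vertex deformation: if $C$ is an even hole and $\mathbf{j}\notin C$ has $\Gamma_C(\mathbf{j})=\{\mathbf{u},\mathbf{k},\mathbf{v}\}$ where $\mathbf{u},\mathbf{v}$ are the two neighbours of $\mathbf{k}$ in $C$, then $(C\setminus\{\mathbf{k}\})\cup\{\mathbf{j}\}$ is again an even hole, called a single-vertex deformation of $C$. The deformation closure $\langle C_0\rangle$ of an even hole $C_0$ is the smallest set of holes containing $C_0$ and closed under single-vertex deformations. The generalized cycle symmetry is $J_{\langle C_0\rangle}=\sum_{C\in\langle C_0\rangle}h_C$. Token sliding: for $k\ge 0$ let $\mathsf{TS}_k(G)$ be the graph whose vertices are the independent sets of $G$ of size $k$, two being adjacent if $S'=(S\setminus\{\mathbf{u}\})\cup\{\mathbf{v}\}$ for some edge $\{\mathbf{u},\mathbf{v}\}\in E$ with $\mathbf{u}\in S\setminus S'$, $\mathbf{v}\in S'\setminus S$. For a connected component $\mu$ of $\mathsf{TS}_k(G)$, the token-sliding charge is $Q^{(k,\mu)}_G=\sum_{S\in\mu}h_S$ (for $k=0$ there is a single component and $Q^{(0,\mu)}_G=I$). *)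

(* Defs.v *)
From HB Require Import structures.
From mathcomp Require Import all_boot all_order all_algebra.
Set Implicit Arguments.
Unset Strict Implicit.
Unset Printing Implicit Defensive.
Import GRing.Theory Num.Theory Num.Def.
Local Open Scope ring_scope.

(* An n-qubit Pauli string: each qubit carries 0 = I, 1 = X, 2 = Y, 3 = Z. *)
Definition pauli_string (n : nat) := {ffun 'I_n -> 'I_4}.

Section Pauli.
Variable C : numClosedFieldType.
Variable n : nat.

Definition qbit (k x : nat) : bool := odd (x %/ 2 ^ k).

Definition pauli1 (a : 'I_4) (r c : bool) : C :=
  match val a with
  | 0 => (r == c)%:R
  | 1 => (r != c)%:R
  | 2 => if r then (if c then 0 else 'i)
         else (if c then - 'i else 0)
  | _ => if r == c then (if r then -1 else 1) else 0
  end.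

(* sigma^p = tensor product of the single-qubit Paulis, on C^(2^n) *)
Definition pauli_mx (p : pauli_string n) : 'M[C]_(2 ^ n) :=
  \matrix_(x, y) \prod_(k < n) pauli1 (p k) (qbit k x) (qbit k y).

Definition mx_commute (A B : 'M[C]_(2 ^ n)) : Prop := A *m B = B *m A.

Section Ham.
Variable V : {set pauli_string n}.
Variable b : pauli_string n -> C.

Definition hterm (j : pauli_string n) : 'M[C]_(2 ^ n) := b j *: pauli_mx j.

Definition Ham : 'M[C]_(2 ^ n) := \sum_(j in V) hterm j.

Definition frust (j k : pauli_string n) : bool :=
  [&& j \in V, k \in V & hterm j *m hterm k == - (hterm k *m hterm j)].

Definition claw_free : Prop :=
  forall c a1 a2 a3 : pauli_string n,
    c \in V -> a1 \in V -> a2 \in V -> a3 \in V ->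
    c != a1 -> c != a2 -> c != a3 -> a1 != a2 -> a1 != a3 -> a2 != a3 ->
    frust c a1 -> frust c a2 -> frust c a3 ->
    [|| frust a1 a2, frust a1 a3 | frust a2 a3].

Definition indep (S : {set pauli_string n}) : bool :=
  (S \subset V) && [forall j in S, forall k in S, ~~ frust j k].

(* h_S : product of the terms in S (order irrelevant for independent S) *)
Definition hprod (S : {set pauli_string n}) : 'M[C]_(2 ^ n) :=
  \big[mulmx/1%:M]_(j in S) hterm j.

Definition ts_edge (k : nat) (S S' : {set pauli_string n}) : bool :=
  [&& indep S, indep S', #|S| == k, #|S'| == k &
   [exists u, exists v,
      [&& u \in S, u \notin S', v \in S', v \notin S, frust u v &
          S' == (S :\ u) :|: [set v]]]].

Definition ts_charge (k : nat) (S0 : {set pauli_string n}) : 'M[C]_(2 ^ n) :=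
  \sum_(S | connect (ts_edge k) S0 S) hprod S.

Definition even_hole (Cy : {set pauli_string n}) : bool :=
  [&& (4 <= #|Cy|)%N, ~~ odd #|Cy|, Cy \subset V &
   [exists f : {ffun 'I_#|Cy| -> pauli_string n},
      injectiveb f && (Cy == [set f i | i : 'I_#|Cy|]) &&
      [forall i : 'I_#|Cy|, forall j : 'I_#|Cy|,
         frust (f i) (f j) ==
         ((val j == (val i).+1 %% #|Cy|)%N || (val i == (val j).+1 %% #|Cy|)%N)]]].

Definition hole_colour (Cy : {set pauli_string n}) : option {set pauli_string n} :=
  [pick A : {set pauli_string n} | [&& A \subset Cy, indep A & indep (Cy :\: A)]].

Definition hhole (Cy : {set pauli_string n}) : 'M[C]_(2 ^ n) :=
  match hole_colour Cy with
  | Some A => hprod A *m hprod (Cy :\: A)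
  | None => 0
  end.

Definition deform (Cy Cy' : {set pauli_string n}) : bool :=
  even_hole Cy &&
  [exists j, exists k,
     [&& j \in V, j \notin Cy, k \in Cy,
         [set x in Cy | frust j x] == k |: [set x in Cy | frust k x] &
         Cy' == j |: (Cy :\ k)]].

Definition cycle_sym (C0 : {set pauli_string n}) : 'M[C]_(2 ^ n) :=
  \sum_(Cy | connect deform C0 Cy) hhole Cy.

End Ham.
End Pauli.

(* Main.v *)
Require Import Defs.
From mathcomp Require Import all_boot all_order all_algebra.
From mathcomp Require Import zify ring.
Set Implicit Arguments.
Unset Strict Implicit.
Unset Printing Implicit Defensive.
Import GRing.Theory Num.Theory.
Local Open Scope ring_scope.

(* Write X_F for the sum of the monomials w A over a family F of vertex sets that is closed
   under replacing y in A by x whenever nb A x = {y} + nb A y; token-sliding components and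
   deformation classes of even holes are such families.  In A + x the vertices x and y are
   adjacent twins, and exchanging them negates [w A, h x], so [X_F, H] vanishes in every
   multidegree.

   Given two such families, let O_m be the sum of the [w A, w B] with A + B = m (as multisets).
   By the Jacobi identity [O, H] vanishes in every multidegree as well.  Look at multidegree
   m + z, where z has multiplicity one in m and h z anticommutes with O_m: either O_m = 0, or
   O_{m + z - i} is nonzero for some i <> z.  By descending induction on the number of doubled
   vertices of m, such an i is a doubled neighbour of z ("hop").  When the sets B are
   independent there is none, so O_m = 0.  When A and B are even holes and O_m is nonzero,
   hops propagate along the cycle B, and counting odd vertices along B shows that w A and w B
   commute whenever A + B = m, a contradiction. *)

(** * Commutators in a ring *)

Definition comm (R : pzRingType) (x y : R) : R := x * y - y * x.

Lemma comm_jacobi (R : pzRingType) (x y z : R) :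
  comm (comm x y) z = comm x (comm y z) - comm y (comm x z).
Proof.
rewrite /comm !mulrBl !mulrBr !mulrA.
move: (x * y * z) (y * x * z) (z * x * y) (z * y * x) (x * z * y) (y * z * x).
move=> a b c d e f; rewrite !opprB !addrA.
by rewrite [RHS](AC 8 ((1*8*3*6)*(2*5)*(4*7)))/= !addNr !addr0.
Qed.

Lemma comm_suml (R : pzRingType) (I : Type) (r : seq I) (P : pred I) (u : I -> R) (z : R) :
  comm (\sum_(i <- r | P i) u i) z = \sum_(i <- r | P i) comm (u i) z.
Proof. by rewrite /comm mulr_suml mulr_sumr -sumrB. Qed.

Lemma comm_sumr (R : pzRingType) (I : Type) (r : seq I) (P : pred I) (u : I -> R) (z : R) :
  comm z (\sum_(i <- r | P i) u i) = \sum_(i <- r | P i) comm z (u i).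
Proof. by rewrite /comm mulr_suml mulr_sumr -sumrB. Qed.

Lemma comm_mulrnl (R : pzRingType) (x y : R) n : comm (x *+ n) y = comm x y *+ n.
Proof. by rewrite /comm mulrnAl mulrnAr -mulrnBl. Qed.

Lemma comm_mulrnr (R : pzRingType) (x y : R) n : comm y (x *+ n) = comm y x *+ n.
Proof. by rewrite /comm mulrnAl mulrnAr -mulrnBl. Qed.

Lemma comm0r (R : pzRingType) (x : R) : comm x 0 = 0.
Proof. by rewrite /comm mulr0 mul0r subrr. Qed.

Lemma odd_sum (I : finType) (P : pred I) (f g : I -> nat) :
  (forall i, P i -> odd (f i) = odd (g i)) ->
  odd (\sum_(i | P i) f i) = odd (\sum_(i | P i) g i).
Proof.
by move=> fg; rewrite !(big_morph odd oddD (erefl _)); apply: eq_bigr.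
Qed.

(** * Neighbourhoods, multidegrees and degrees *)

Section Graph.
Variables (T : finType) (adj : rel T).

Definition nb (A : {set T}) x := [set y in A | adj x y].

(** Multidegrees are functions to [nat] with pointwise addition, so [cs A + cs B] is the multiset
    sum and [delta x] adds one more copy of [x]. *)
Definition cs (A : {set T}) : {ffun T -> nat} := [ffun x => nat_of_bool (x \in A)].
Definition delta (x : T) : {ffun T -> nat} := [ffun y => nat_of_bool (x == y)].
(** Its parity gives the sign with which [h x] passes an element of multidegree [m]. *)
Definition deg (m : {ffun T -> nat}) x : nat := (\sum_(y | adj x y) m y)%N.

Lemma card_nb A x : #|nb A x| = (\sum_(y in A) adj x y)%N.
Proof.
rewrite -sum1_card big_mkcond [RHS]big_mkcond; apply: eq_bigr => y _.
by rewrite inE; case: (y \in A) (adj x y) => [] [].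
Qed.

Lemma sum_nb_swap (A B : {set T}) : symmetric adj ->
  (\sum_(x in A) #|nb B x| = \sum_(y in B) #|nb A y|)%N.
Proof.
move=> adj_sym; under eq_bigr do rewrite card_nb; rewrite exchange_big /=.
by apply: eq_bigr => y _; rewrite card_nb; apply: eq_bigr => x _; rewrite adj_sym.
Qed.

Lemma deg_cs A x : deg (cs A) x = #|nb A x|.
Proof.
rewrite /deg card_nb big_mkcond [RHS]big_mkcond; apply: eq_bigr => y _.
by rewrite ffunE; case: (y \in A) (adj x y) => [] [].
Qed.

Lemma deg_delta y x : deg (delta y) x = adj x y.
Proof.
rewrite /deg big_mkcond (bigD1 y)//= ffunE eqxx big1 ?addn0; first by case: (adj x y).
by move=> z zy; rewrite ffunE eq_sym (negbTE zy); case: ifP.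
Qed.

Lemma degD m1 m2 x : deg (m1 + m2) x = (deg m1 x + deg m2 x)%N.
Proof. by rewrite /deg -big_split; apply: eq_bigr => y _; rewrite ffunE. Qed.

Definition doubles (m : {ffun T -> nat}) := [set x | m x == 2].

End Graph.

(** * Enumerated cycles *)

Section Cycle.
Local Open Scope nat_scope.
Variables (T : finType) (adj : rel T).
Hypothesis adj_sym : symmetric adj.
Notation nb := (nb adj).

(** Indexing by all of [nat] with period [N] lets an enumeration be shifted, reversed and followed
    around the cycle without treating the wrap-around apart. *)
Record cycle_enum (B : {set T}) (N : nat) (g : nat -> T) : Prop := CycleEnum {
  ce_big : (3 < N)%N;
  ce_even : ~~ odd N;
  ce_eq : forall s t, (g s == g t) = (s == t %[mod N]);
  ce_adj : forall s t, adj (g s) (g t) = (s.+1 == t %[mod N]) || (t.+1 == s %[mod N]);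
  ce_mem : forall x, x \in B <-> exists t, x = g t }.

Section Theory.
Variables (B : {set T}) (N : nat) (g : nat -> T).
Hypothesis gB : cycle_enum B N g.

Let N_gt3 : (3 < N)%N := ce_big gB.

Lemma ce_in t : g t \in B. Proof. by apply/(ce_mem gB); exists t. Qed.

Lemma ce_lt x : x \in B -> exists2 t, (t < N)%N & x = g t.
Proof.
case/(ce_mem gB) => t ->; exists (t %% N)%N; first by rewrite ltn_mod; lia.
by apply/eqP; rewrite (ce_eq gB) modn_mod.
Qed.

Lemma ce_addN t : g (t + N)%N = g t.
Proof. by apply/eqP; rewrite (ce_eq gB) modnDr. Qed.

Lemma ce_nb t : nb B (g t) = [set g t.+1; g (t + N.-1)%N].
Proof.
have predN s : (s.+1 == t %[mod N]) = (s == t + N.-1 %[mod N]).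
  by rewrite -(eqn_modDr 1 s) -addnA [(N.-1 + 1)%N]addn1 prednK ?modnDr ?addn1 //; lia.
apply/setP => z; rewrite !inE; apply/andP/idP => [[/(ce_mem gB)[s ->]]|/orP[]/eqP->].
- by rewrite (ce_adj gB) !(ce_eq gB) predN [t.+1 %% _ == _]eq_sym.
- by rewrite ce_in (ce_adj gB) eqxx.
- by rewrite ce_in (ce_adj gB) predN eqxx orbT.
Qed.

Lemma ce_neq s t : (s < t < s + N)%N -> g s != g t.
Proof.
move=> lt; rewrite (ce_eq gB); apply/negP => /eqP e.
have : (t - s == 0 %[mod N])%N by rewrite -(eqn_modDr s) add0n subnK ?e //; lia.
rewrite mod0n modn_small; lia.
Qed.

Lemma ce_card x : x \in B -> #|nb B x| = 2.
Proof.
case/(ce_mem gB) => t ->; rewrite ce_nb cards2 ce_neq //; lia.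
Qed.

(** Since [N] is even, reduction modulo [N] keeps parity, so the parity of the index two-colours the
    cycle. *)
Lemma ce_odd s t : adj (g s) (g t) -> odd t = ~~ odd s.
Proof.
rewrite (ce_adj gB) => /orP[]/eqP/(congr1 odd); rewrite !odd_mod ?(negbTE (ce_even gB))  //= => <-;
by rewrite ?negbK.
Qed.

Lemma ce_triangle x y z :
  x \in B -> y \in B -> z \in B -> adj x y -> adj y z -> adj x z -> False.
Proof.
move=> /(ce_mem gB)[s ->] /(ce_mem gB)[t ->] /(ce_mem gB)[u ->].
by move=> /ce_odd ts /ce_odd ut /ce_odd; rewrite ut ts; case: (odd s).
Qed.

Lemma ce_adj_lt s t : (s < t < N)%N ->
  adj (g s) (g t) = (t == s.+1) || (s == 0%N) && (t == N.-1).
Proof.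
move=> /andP[st tN]; rewrite (ce_adj gB).
have sN : s.+1 < N by lia.
rewrite (modn_small sN) (modn_small tN) (modn_small (ltnW sN)).
have [e|tN1] := eqVneq t N.-1.
  have -> : t.+1 = N by lia.
  by rewrite modnn andbT [0 == s]eq_sym [t == _]eq_sym.
have tN' : t.+1 < N by lia.
rewrite (modn_small tN'); lia.
Qed.

Lemma ce_shift t0 : cycle_enum B N (fun t => g (t0 + t)%N).
Proof.
split; rewrite ?(ce_even gB) //.
- by move=> s t; rewrite (ce_eq gB) eqn_modDl.
- by move=> s t; rewrite (ce_adj gB) -!addnS !eqn_modDl.
move=> x; split=> [/(ce_mem gB)[t ->]|[t ->]]; last exact: ce_in.
exists (t + (N - t0 %% N))%N; apply/eqP; rewrite (ce_eq gB) addnCA.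
have lt := ltn_pmod t0 (ltn_trans (isT : (0 < 3)%N) N_gt3).
by rewrite -modnDm -[(t0 + _) %% N]modnDml subnKC ?modnn ?addn0 ?modn_mod // ltnW.
Qed.

(** Multiplication by [N.-1] is negation modulo [N], an involution that exchanges successor and
    predecessor. *)
Lemma ce_reflect : cycle_enum B N (fun t => g (N.-1 * t)%N).
Proof.
have phiK t : (N.-1 * (N.-1 * t) == t %[mod N])%N.
  have -> : N.-1 * (N.-1 * t) = (N - 2) * t * N + t.
    by have := N_gt3; case: (N) => [|[|n]] //= _; rewrite !subSS subn0; nia.
  by rewrite modnMDl.
have phi_mod s t : (s == t %[mod N])%N -> (N.-1 * s == N.-1 * t %[mod N])%N.
  by move=> /eqP e; rewrite -modnMmr e modnMmr.
have phi_eq s t : (N.-1 * s == N.-1 * t %[mod N])%N = (s == t %[mod N])%N.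
  apply/idP/idP => [/phi_mod|]; last exact: phi_mod.
  by rewrite (eqP (phiK s)) (eqP (phiK t)).
have phiS s t : ((N.-1 * s).+1 == N.-1 * t %[mod N])%N = (t.+1 == s %[mod N])%N.
  rewrite -(phi_eq t.+1) mulnS -(eqn_modDr 1 (_ + _)).
  have e u : N.-1 + u + 1 = u + N.
    by rewrite addnAC addn1 prednK ?[N + u]addnC // (ltn_trans _ N_gt3).
  rewrite e.
  by rewrite modnDr addn1 eq_sym.
split; rewrite ?(ce_even gB) //.
- by move=> s t; rewrite (ce_eq gB) phi_eq.
- by move=> s t; rewrite (ce_adj gB) !phiS orbC.
move=> x; split=> [/(ce_mem gB)[t ->]|[t ->]]; last exact: ce_in.
by exists (N.-1 * t)%N; apply/eqP; rewrite (ce_eq gB) eq_sym; apply: phiK.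
Qed.

End Theory.

(** On [B :\ y] the vertices [x] and [y] have the same neighbours, so [x] takes over the place of
    [y] in the enumeration. *)
Lemma ce_move B N g x y : irreflexive adj -> cycle_enum B N g -> x \notin B -> y \in B ->
  nb B x = y |: nb B y ->
  cycle_enum (x |: (B :\ y)) N (fun t => if g t == y then x else g t).
Proof.
move=> irr cB xB yB /setP nbx; pose f z := if z == y then x else z.
have f_eq z z' : z \in B -> z' \in B -> (f z == f z') = (z == z').
  have xN u : u \in B -> (x == u) = false by move=> uB; apply: contraNF xB => /eqP->.
  rewrite /f => zB z'B; case: (z =P y) => [->|zy]; case: (z' =P y) => [->|/eqP z'y] //.
  - by rewrite !eqxx.
  - by rewrite xN // eq_sym (negbTE z'y).
  - by rewrite eq_sym xN //; apply/esym/eqP.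
have adjx z : z \in B -> z != y -> adj x z = adj y z.
  by move=> zB zy; move: (nbx z); rewrite !inE zB (negbTE zy).
have f_adj z z' : z \in B -> z' \in B -> adj (f z) (f z') = adj z z'.
  rewrite /f => zB z'B; case: (z =P y) => [->|/eqP zy]; case: (z' =P y) => [->|/eqP z'y] //.
  - by rewrite !irr.
  - exact: adjx.
  - by rewrite adj_sym adjx // adj_sym.
have [big ev eqg adjg memg] := cB; split=> //.
- by move=> s t; rewrite f_eq ?(ce_in cB) // eqg.
- by move=> s t; rewrite f_adj ?(ce_in cB) // adjg.
move=> z; rewrite !inE; split.
  case/orP=> [/eqP->|/andP[zy /memg[t e]]]; last first.
    by exists t; rewrite -e (negbTE zy).
  by have [t <-] : exists t, g t = y; [have /memg[t ->] := yB; exists t|exists t; rewrite eqxx].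
case=> t ->; case: (g t =P y) => [_|/eqP ty]; first by rewrite eqxx.
by rewrite ty (ce_in cB) orbT.
Qed.

Lemma ce_orient B N g x y : cycle_enum B N g -> x \in B -> y \in nb B x ->
  exists g', [/\ cycle_enum B N g', g' 0%N = x & g' 1%N = y].
Proof.
move=> gB /(ce_mem gB)[t ->]; rewrite (ce_nb gB) !inE => /orP[]/eqP->.
  by exists (fun s => g (t + s)%N); rewrite addn0 addn1; split=> //; apply: ce_shift.
exists (fun s => g (t + N.-1 * s)%N); rewrite muln0 muln1 addn0; split=> //.
exact: (ce_reflect (ce_shift gB t)).
Qed.

End Cycle.

(** * Graded commutators of charge families *)

Section Charges.
Variables (T : finType) (adj : rel T) (R : pzRingType) (V : {set T}) (h : T -> R).
Hypothesis adj_sym : symmetric adj.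
Hypothesis adj_irr : irreflexive adj.
Hypothesis h_sign : forall x y, x \in V -> y \in V ->
  h x * h y = (-1) ^+ adj x y * (h y * h x).
Hypothesis h_reg : forall x r, x \in V -> r * h x = 0 -> r = 0.
Hypothesis two_reg : forall r : R, r + r = 0 -> r = 0.

Notation nb := (nb adj).
Notation deg := (deg adj).

(* fam_twin makes the vertex y of fam_move unique. *)
Record charge_family (F : {set {set T}}) (w : {set T} -> R) : Prop := ChargeFamily {
  fam_sub : forall A, A \in F -> A \subset V;
  fam_sign : forall A (r : R) (s : T -> nat), A \in F ->
    (forall x, x \in A -> h x * r = (-1) ^+ s x * (r * h x)) ->
    w A * r = (-1) ^+ (\sum_(x in A) s x)%N * (r * w A);
  fam_even : forall A x, A \in F -> x \in A -> ~~ odd #|nb A x|;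
  fam_move : forall A x, A \in F -> x \in V -> x \notin A -> odd #|nb A x| ->
    exists2 y, y \in A & [/\ nb A x = y |: nb A y, x |: (A :\ y) \in F
                       & w (x |: (A :\ y)) * h y = - (w A * h x)];
  fam_twin : forall A y z, A \in F -> y \in A -> z \in A ->
    y |: nb A y = z |: nb A z -> y = z }.

Lemma signK b (r : R) n : (-1) ^+ n * r = b -> r = (-1) ^+ n * b.
Proof. by move=> <-; rewrite mulrA -exprD addnn -mul2n exprM sqrrN expr1n expr1n mul1r. Qed.

Lemma comm_even n (x y : R) : ~~ odd n -> x * y = (-1) ^+ n * (y * x) -> comm x y = 0.
Proof. by move=> /negbTE on e; rewrite /comm e -signr_odd on mul1r subrr. Qed.

Lemma comm_odd n (x y : R) : odd n -> x * y = (-1) ^+ n * (y * x) ->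
  comm x y = x * y + x * y.
Proof.
by move=> on e; rewrite /comm [in RHS]e -signr_odd on {1}e -signr_odd on expr1 mulN1r.
Qed.

Lemma signM a b (x y z : R) :
  x * z = (-1) ^+ a * (z * x) -> y * z = (-1) ^+ b * (z * y) ->
  x * y * z = (-1) ^+ (a + b) * (z * (x * y)).
Proof.
move=> ex ey; rewrite -mulrA ey [LHS]mulrA (commr_sign x b) -[LHS]mulrA.
by rewrite [x * _]mulrA ex -!mulrA [LHS]mulrA -exprD addnC.
Qed.

(** * One family: commutation with the Hamiltonian, degree by degree *)

Section OneFamily.
Variables (F : {set {set T}}) (w : {set T} -> R).
Hypothesis FF : charge_family F w.

Lemma w_sign A x : A \in F -> x \in V ->
  w A * h x = (-1) ^+ #|nb A x| * (h x * w A).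
Proof.
move=> AF xV; rewrite (fam_sign (s := fun y => adj x y) FF AF).
  by rewrite card_nb.
move=> y yA; have yV := subsetP (fam_sub FF AF) _ yA.
by rewrite h_sign // adj_sym.
Qed.

Lemma comm_w_even A x : A \in F -> x \in V -> ~~ odd #|nb A x| -> comm (w A) (h x) = 0.
Proof. by move=> AF xV on; apply: comm_even on _; apply: w_sign. Qed.

Lemma comm_w_odd A x : A \in F -> x \in V -> odd #|nb A x| ->
  comm (w A) (h x) = w A * h x + w A * h x.
Proof. by move=> AF xV on; apply: comm_odd on _; apply: w_sign. Qed.

(** Reindexing by [f] shows the sum to be its own opposite; concluding by [two_reg] makes fixed
    points of [f] harmless. *)
Lemma involution_sum0 (I : finType) (P : pred I) (f : I -> I) (u : I -> R) :
  {in P, forall i, [/\ f i \in P, f (f i) = i & u (f i) = - u i]} ->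
  \sum_(i | P i) u i = 0.
Proof.
move=> fP; apply: two_reg; rewrite {1}(reindex_onto f f) => [|i Pi]; last by case: (fP i Pi).
rewrite (eq_bigl P) => [|i].
  by rewrite -big_split /= big1 // => i Pi; case: (fP i Pi) => _ _ ->; rewrite addNr.
apply/andP/idP => [[Pfi /eqP ffi]|Pi]; first by case: (fP _ Pfi); rewrite ffi.
by case: (fP i Pi) => ? -> _.
Qed.

Definition twin (A : {set T}) (x : T) : T := odflt x [pick y in A | nb A x == y |: nb A y].

Lemma twinP (A : {set T}) x : A \in F -> x \in V -> odd #|nb A x| ->
  [/\ x \notin A, twin A x \in A, nb A x = twin A x |: nb A (twin A x),
      x |: (A :\ twin A x) \in F
    & w (x |: (A :\ twin A x)) * h (twin A x) = - (w A * h x)].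
Proof.
move=> AF xV on; have xA : x \notin A by apply: contraL on => /(fam_even FF AF).
have [y yA [e A'F wA']] := fam_move FF AF xV xA on.
suff -> : twin A x = y by [].
rewrite /twin; case: pickP => [z /andP[zA /eqP e2]|/(_ y)]; last by rewrite yA e eqxx.
by apply: (fam_twin FF AF zA yA); rewrite -e -e2.
Qed.

(** In the union of [A] and [x] the two twins have equal closed neighbourhoods, so the exchange is
    undone by the same rule and is an involution on pairs. *)
Lemma twin_swap (A : {set T}) x (y := twin A x) (A' := x |: (A :\ y)) :
  A \in F -> x \in V -> odd #|nb A x| ->
  [/\ y \in V, odd #|nb A' y|, twin A' y = x & y |: (A' :\ x) = A].
Proof.
move=> AF xV on; have [xA yA e A'F _] := twinP AF xV on; rewrite -/y in yA e A'F.
have yx : y != x by apply: contraNneq xA => <-.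
have adjxy : adj x y.
  by have: y \in nb A x; [rewrite e !inE eqxx|rewrite inE => /andP[]].
have yV : y \in V by apply: (subsetP (fam_sub FF AF)).
have ynb z : z \in A -> z != y -> adj x z = adj y z.
  by move=> zA zy; move/setP: e => /(_ z); rewrite !inE zA (negbTE zy).
have nbx : nb A' x = nb A y.
  apply/setP => z; rewrite !inE; have [->|zx] := eqVneq z x.
    by rewrite adj_irr (negbTE xA) andbF.
  have [->|zy] /= := eqVneq z y; first by rewrite adj_irr andbF.
  by case: (boolP (z \in A)) => //= zA; rewrite ynb.
have nby : nb A' y = x |: nb A y.
  apply/setP => z; rewrite !inE; have [->|zx] := eqVneq z x; first by rewrite adj_sym.
  by have [->|zy] := eqVneq z y; rewrite ?adj_irr ?andbF.
have oy : odd #|nb A' y|.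
  by move: on; rewrite e nby !cardsU1 !inE adj_irr (negbTE xA) andbF /=.
have tA' : twin A' y = x.
  have [_ tA' e' _ _] := twinP A'F yV oy.
  by apply: (fam_twin FF A'F) => //; rewrite ?inE ?eqxx // -e' nby nbx.
split=> //; apply/setP => z; rewrite !inE; have [->|zy] := eqVneq z y; first by rewrite yA.
by have [->|] := eqVneq z x; rewrite ?(negbTE xA).
Qed.

(** Pairs with an even number of neighbours commute. The others cancel under the exchange of [x]
    with its twin, which keeps the multiset [A + x], hence any predicate [P] on it. *)
Lemma comm_h_sum (P : pred {ffun T -> nat}) :
  \sum_(A in F) \sum_(x in V) comm (w A) (h x) *+ P (cs A + delta x) = 0.
Proof.
rewrite pair_big_dep /=.
pose Q (p : {set T} * T) := [&& p.1 \in F, p.2 \in V, odd #|nb p.1 p.2|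
                             & P (cs p.1 + delta p.2)].
rewrite (bigID Q) /= [X in _ + X]big1 ?addr0; last first.
  move=> [A x] /= /andP[/andP[AF xV]]; rewrite /Q /= AF xV /=.
  case: (boolP (odd _)) => [on /= /negbTE->|ev _]; first by rewrite mulr0n.
  by rewrite comm_w_even // mul0rn.
rewrite (eq_bigl Q) => [|[A x]]; last by rewrite /Q /=; case: (A \in F); case: (x \in V).
pose phi (p : {set T} * T) := (p.2 |: (p.1 :\ twin p.1 p.2), twin p.1 p.2).
apply: (involution_sum0 (f := phi)) => -[A x] /and4P[/= AF xV on PA].
have [xA yA _ A'F wA'] := twinP AF xV on.
have [yV oy tA' eA] := twin_swap AF xV on.
have eP : cs (x |: (A :\ twin A x)) + delta (twin A x) = cs A + delta x.
  apply/ffunP => z; rewrite !ffunE !inE.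
  have yx : twin A x != x by apply: contraNneq xA => {1}<-.
  have [->|zy] := eqVneq z (twin A x).
    by rewrite (negbTE yx) yA [x == _]eq_sym (negbTE yx).
  by have [->|] := eqVneq z x; rewrite ?(negbTE xA).
split; first by rewrite /Q unfold_in /= A'F yV oy eP PA.
  by rewrite /phi /= tA' eA.
by rewrite /= eP !comm_w_odd // wA' PA /= !mulr1n opprD.
Qed.

Lemma comm_hamiltonian : comm (\sum_(A in F) w A) (\sum_(x in V) h x) = 0.
Proof.
rewrite -[RHS](comm_h_sum predT) comm_suml; apply: eq_bigr => A _.
by rewrite comm_sumr.
Qed.

End OneFamily.

(** * Two families: their commutators sorted by multidegree *)

Section TwoFamilies.
Variables (F G : {set {set T}}) (w v : {set T} -> R).
Hypotheses (FF : charge_family F w) (FG : charge_family G v).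

(* A boolean multiplicity [*+ (_ == m)] keeps the summands of multidegree m. *)
Definition graded_comm (m : {ffun T -> nat}) : R :=
  \sum_(A in F) \sum_(B in G) comm (w A) (v B) *+ (cs A + cs B == m).

Lemma cs_addrI (m1 m2 m : {ffun T -> nat}) : (m1 + m == m2 + m) = (m1 == m2).
Proof.
apply/eqP/eqP => [/ffunP e|->//]; apply/ffunP => x.
by move: (e x); rewrite !ffunE => /addIn.
Qed.

Lemma sum_neq0 (I : finType) (P : pred I) (u : I -> R) :
  \sum_(i | P i) u i != 0 -> exists2 i, P i & u i != 0.
Proof.
move=> s0; case: (pickP [pred i | P i && (u i != 0)]) => [i /andP[Pi ui]|no]; first by exists i.
by case/eqP: s0; apply: big1 => i Pi; have /= := no i; rewrite Pi => /negbT /negbNE /eqP.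
Qed.

Lemma graded_comm_pair m : graded_comm m != 0 -> exists A B,
  [/\ A \in F, B \in G, cs A + cs B = m & comm (w A) (v B) != 0].
Proof.
case/sum_neq0 => A AF /sum_neq0[B BG].
case: (cs A + cs B =P m) => [e c0|_]; last by rewrite eqxx.
by exists A, B; split.
Qed.

(** Moving [v B] past [w A] costs one sign for each adjacent pair between [B] and [A]. *)
Lemma comm_wv_odd A B : A \in F -> B \in G -> comm (w A) (v B) != 0 ->
  odd (\sum_(x in B) #|nb A x|)%N.
Proof.
move=> AF BG; apply: contraNT => ev.
suff e : v B * w A = (-1) ^+ (\sum_(x in B) #|nb A x|)%N * (w A * v B).
  by rewrite /comm e -signr_odd (negbTE ev) mul1r subrr.
apply: (fam_sign FG BG) => x xB; apply: signK; rewrite -(w_sign FF) //.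
exact: (subsetP (fam_sub FG BG)).
Qed.

Lemma comm_wv_sign A B x : A \in F -> B \in G -> x \in V ->
  comm (w A) (v B) * h x = (-1) ^+ deg (cs A + cs B) x * (h x * comm (w A) (v B)).
Proof.
move=> AF BG xV; rewrite degD !deg_cs /comm mulrBl mulrBr mulrBr.
have eA := w_sign FF AF xV; have eB := w_sign FG BG xV.
by rewrite (signM eA eB) (signM eB eA) [(_ + #|nb A x|)%N]addnC.
Qed.

Lemma graded_comm_sign m x : x \in V ->
  graded_comm m * h x = (-1) ^+ deg m x * (h x * graded_comm m).
Proof.
move=> xV; rewrite /graded_comm mulr_suml !mulr_sumr; apply: eq_bigr => A AF.
rewrite mulr_suml !mulr_sumr; apply: eq_bigr => B BG.
by case: eqP => [<-|_] /=; rewrite ?mulr1n ?mulr0n ?mul0r ?mulr0 // comm_wv_sign.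
Qed.

Definition graded_comm_at M x : R :=
  \sum_(A in F) \sum_(B in G) comm (w A) (v B) *+ (cs A + cs B + delta x == M).

(** The Jacobi identity leaves brackets of [w A] with [[v B, h x]] and of [v B] with [[w A, h x]];
    for fixed [A], respectively fixed [B], the remaining sum vanishes by [comm_h_sum]. *)
Lemma graded_comm_h M : \sum_(x in V) comm (graded_comm_at M x) (h x) = 0.
Proof.
have e x : comm (graded_comm_at M x) (h x) =
    \sum_(A in F) \sum_(B in G)
      comm (w A) (comm (v B) (h x) *+ (cs A + (cs B + delta x) == M)) -
    \sum_(B in G) \sum_(A in F)
      comm (v B) (comm (w A) (h x) *+ (cs B + (cs A + delta x) == M)).
  rewrite comm_suml [X in _ - X]exchange_big /= -sumrB; apply: eq_bigr => A _.
  rewrite comm_suml -sumrB; apply: eq_bigr => B _.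
  rewrite comm_mulrnl comm_jacobi mulrnBl !comm_mulrnr addrA [cs B + _]addrA.
  by rewrite [cs B + cs A]addrC.
rewrite (eq_bigr _ (fun x _ => e x)) sumrB exchange_big [X in _ - X]exchange_big /=.
rewrite [X in X - _]big1 ?[X in _ - X]big1 ?subrr // => [B BG|A AF].
  have e0 := comm_h_sum FF (fun N => cs B + N == M).
  rewrite exchange_big -[RHS](comm0r (v B)) -[in RHS]e0 comm_sumr.
  by apply: eq_bigr => A AF; rewrite comm_sumr.
have e0 := comm_h_sum FG (fun N => cs A + N == M).
rewrite exchange_big -[RHS](comm0r (w A)) -[in RHS]e0 comm_sumr.
by apply: eq_bigr => B BG; rewrite comm_sumr.
Qed.

(** In degree [m + delta z] the term of [z] in [graded_comm_h] is nonzero, so some [x] other than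
    [z] contributes too. If [x] were not doubled in [m], trading it for [z] would give more doubled
    vertices; if [x] were not adjacent to [z], then [h x] would commute with the new graded
    commutator. *)
Lemma graded_comm_hop m z : graded_comm m != 0 ->
  (forall m', (#|doubles m| < #|doubles m'|)%N -> graded_comm m' = 0) ->
  m z = 1 -> odd (deg m z) ->
  exists m' i, [/\ m' + delta i = m + delta z, m i = 2, adj z i & graded_comm m' != 0].
Proof.
move=> Om top mz oz; have [A0 [B0 [A0F B0G em _]]] := graded_comm_pair Om.
have zV : z \in V.
  have : (0 < m z)%N by rewrite mz.
  rewrite -em !ffunE; case: (boolP (z \in A0)) => [/(subsetP (fam_sub FF A0F))//|_].
  by case: (boolP (z \in B0)) => [/(subsetP (fam_sub FG B0G))|].
have := graded_comm_h (m + delta z); rewrite (bigD1 z) //=.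
have -> : graded_comm_at (m + delta z) z = graded_comm m.
  rewrite /graded_comm_at /graded_comm; apply: eq_bigr => A _.
  by apply: eq_bigr => B _; rewrite cs_addrI.
set S := (X in _ + X) => sum0.
have : S != 0.
  apply: contraNneq Om => S0; move: sum0; rewrite S0 addr0.
  rewrite (comm_odd oz (graded_comm_sign _ zV)) -mulrDl => e0.
  by apply/eqP; apply: two_reg; apply: (h_reg zV e0).
case/sum_neq0 => x /andP[xV xz] nz.
have : graded_comm_at (m + delta z) x != 0.
  by apply: contraNneq nz => ->; rewrite /comm mul0r mulr0 subrr.
case/sum_neq0 => A AF /sum_neq0[B BG].
case: (cs A + cs B + delta x =P m + delta z) => [eM _|_]; last by rewrite eqxx.
set m' := cs A + cs B in eM.
have eO : graded_comm_at (m + delta z) x = graded_comm m'.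
  rewrite /graded_comm_at /graded_comm -eM; apply: eq_bigr => A' _.
  by apply: eq_bigr => B' _; rewrite cs_addrI.
rewrite eO in nz; have Om' : graded_comm m' != 0.
  by apply: contraNneq nz => ->; rewrite /comm mul0r mulr0 subrr.
have em' y : (m' y + (x == y) = m y + (z == y))%N.
  by move/ffunP: eM => /(_ y); rewrite !ffunE.
have m2 y : (m y <= 2)%N by rewrite -em !ffunE; case: (y \in A0) (y \in B0) => [] [].
have mx : m x = 2.
  have := em' x; rewrite eqxx eq_sym (negbTE xz) addn1 addn0 => mx.
  have := m2 x; rewrite -mx ltnS leq_eqVlt ltnS leqn0 => /orP[/eqP-> //|/eqP m'x].
  (* Remaining case [m x = 1]: passing to [m'] loses no doubled vertex and gains [z]. *)
  case/eqP: Om'; apply: top; apply: proper_card; apply/properP; split.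
    apply/subsetP => y; rewrite !inE => /eqP my; have := em' y; rewrite my.
    have [e|] := eqVneq x y; first by move: mx; rewrite e my => -[my0]; rewrite -e m'x in my0.
    have [e|] := eqVneq z y; first by move: my; rewrite -e mz.
    by rewrite !addn0 => _ _ ->.
  exists z; rewrite !inE ?mz //; have := em' z; rewrite eqxx (negbTE xz) addn0 mz => ->.
  by [].
exists m', x; split => //; apply: contraNT nz => zx.
(* Without an edge between [x] and [z], the degree of [x] is the same in [m'] as in [m], where it is
   even because [x] lies in both [A0] and [B0]. *)
have ex : ~~ odd (deg m' x).
  have : deg (m' + delta x) x = deg (m + delta z) x by rewrite eM.
  rewrite !degD !deg_delta adj_irr addn0 adj_sym (negbTE zx) addn0 => ->.
  have /andP[xA xB] : (x \in A0) && (x \in B0).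
    by move: mx; rewrite -em !ffunE; case: (x \in A0) (x \in B0) => [] [].
  rewrite -em degD !deg_cs oddD.
  by rewrite (negbTE (fam_even FF A0F xA)) (negbTE (fam_even FG B0G xB)).
by rewrite (comm_even ex) ?graded_comm_sign.
Qed.

(** The hop doubles [z] and makes [i] simple, so maximality of the number of doubled vertices
    survives it. *)
Lemma graded_comm_hop_doubles (m m' : {ffun T -> nat}) z i :
  m' + delta i = m + delta z -> m i = 2 -> m z = 1 -> #|doubles m'| = #|doubles m|.
Proof.
move=> eM mi mz; have em y : (m' y + (i == y) = m y + (z == y))%N.
  by move/ffunP: eM => /(_ y); rewrite !ffunE.
have zi : z != i by apply/eqP => e; move: mi; rewrite -e mz.
have dm : doubles m' = z |: (doubles m :\ i).
  apply/setP => y; have := em y; rewrite !inE.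
  have [<-|zy] := eqVneq z y; first by rewrite [i == z]eq_sym (negbTE zi) mz addn0 => ->.
  have [<-|iy] := eqVneq i y; first by rewrite mi addn0 addn1 => -[->].
  by rewrite !addn0 => ->.
rewrite dm cardsU1 !inE mz andbF (cardsD1 i (doubles m)) inE mi eqxx.
by [].
Qed.

(** Pairs of sets are sorted by multidegree; multiplicities are at most 2, so functions to ['I_3]
    form a finite index type. *)
Lemma graded_comm_total :
  (forall m, graded_comm m = 0) -> comm (\sum_(A in F) w A) (\sum_(B in G) v B) = 0.
Proof.
move=> O0; rewrite comm_suml.
under eq_bigr do rewrite comm_sumr.
rewrite pair_big_dep /=.
pose key (p : {set T} * {set T}) : {ffun T -> 'I_3} :=
  [ffun x => inord ((x \in p.1) + (x \in p.2))].
rewrite (partition_big key xpredT) //= big1 // => q _.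
rewrite -[RHS](O0 [ffun x => val (q x)]) /graded_comm pair_big_dep big_mkcondr /=.
apply: eq_bigr => -[A B] _ /=; rewrite -mulrb; congr (_ *+ nat_of_bool _).
apply/eqP/eqP => [<-|e]; apply/ffunP => x.
  by rewrite !ffunE /= inordK //; case: (x \in A) (x \in B) => [] [].
apply: val_inj; move/ffunP: e => /(_ x); rewrite !ffunE /= => <-.
by rewrite inordK //; case: (x \in A) (x \in B) => [] [].
Qed.

(** Descending induction on the number of doubled vertices, which is at most [#|T|]: only degrees
    with nothing nonzero above them are left to exclude. *)
Lemma graded_comm_vanish :
  (forall m, graded_comm m != 0 ->
     (forall m', (#|doubles m| < #|doubles m'|)%N -> graded_comm m' = 0) -> False) ->
  comm (\sum_(A in F) w A) (\sum_(B in G) v B) = 0.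
Proof.
move=> top; apply: graded_comm_total => m.
have [n] := ubnP (#|T| - #|doubles m|)%N; elim: n m => // n IHn m le_n.
apply/eqP; apply: contraT => Om; case: (top m Om) => m' lt_mm'.
apply: IHn; have := max_card (doubles m'); lia.
Qed.

(** A nonzero commutator yields a vertex [z] of [B] with an odd number of neighbours in [A]. Its hop
    would end at a doubled neighbour, which lies with [z] in the independent set [B]. *)
Lemma comm_indep :
  (forall B, B \in G -> {in B &, forall x y, ~~ adj x y}) ->
  comm (\sum_(A in F) w A) (\sum_(B in G) v B) = 0.
Proof.
move=> indG; apply: graded_comm_vanish => m Om top.
have [A [B [AF BG em c0]]] := graded_comm_pair Om.
have [z zB oz] : exists2 z, z \in B & odd #|nb A z|.
  case: (pickP [pred z in B | odd #|nb A z|]) => [z /andP[zB oz]|no]; first by exists z.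
  have := comm_wv_odd AF BG c0.
  rewrite (big_morph odd oddD (erefl _)) big1 // => z zB.
  by have := no z; rewrite /= zB.
have zA : z \notin A by apply: contraL oz => /(fam_even FF AF).
have nbB : nb B z = set0.
  by apply/setP => y; rewrite !inE; case: (boolP (y \in B)) => // /(indG B BG z y zB)/negbTE.
have [||m' [i [_ mi zi _]]] := graded_comm_hop Om top (z := z).
- by rewrite -em !ffunE zB (negbTE zA).
- by rewrite -em degD !deg_cs nbB cards0 addn0.
have iB : i \in B by move: mi; rewrite -em !ffunE; case: (i \in A) (i \in B) => [] [].
by have := indG B BG z i zB iB; rewrite zi.
Qed.

Definition top_graded m := graded_comm m != 0 /\
  forall m', (#|doubles m| < #|doubles m'|)%N -> graded_comm m' = 0.

Lemma top_graded_hop m z : top_graded m -> m z = 1 -> odd (deg m z) ->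
  exists m' i, [/\ m' + delta i = m + delta z, m i = 2, adj z i & top_graded m'].
Proof.
move=> [Om top] mz oz; have [m' [i [em mi zi Om']]] := graded_comm_hop Om top mz oz.
exists m', i; split=> //; split=> // m2.
by rewrite (graded_comm_hop_doubles em mi mz); apply: top.
Qed.

Lemma hopE (m m' : {ffun T -> nat}) i z y :
  m' + delta i = m + delta z -> (m' y + (i == y) = m y + (z == y))%N.
Proof. by move/ffunP/(_ y); rewrite !ffunE. Qed.

Lemma hop_deg (m m' : {ffun T -> nat}) i z y :
  m' + delta i = m + delta z -> (deg m' y + adj y i = deg m y + adj y z)%N.
Proof. by move=> e; rewrite -!deg_delta -!degD e. Qed.

Lemma csE (A B : {set T}) x : (cs A + cs B) x = ((x \in A) + (x \in B))%N.
Proof. by rewrite !ffunE. Qed.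

Lemma double_mem (A B : {set T}) x : (cs A + cs B) x = 2 -> (x \in A) && (x \in B).
Proof. by rewrite csE; case: (x \in A) (x \in B) => [] []. Qed.

(* If z in B had two doubled neighbours i and j, then nb A z = {k, i, j} with k adjacent to
   both; after the hop from i to z, whichever of A' and B' contains k contains a triangle. *)
Lemma no_double_hop A B A' B' NA NB NA' NB' gA gB gA' gB' z k i j :
  cycle_enum adj A NA gA -> cycle_enum adj B NB gB ->
  cycle_enum adj A' NA' gA' -> cycle_enum adj B' NB' gB' ->
  z \in B -> z \notin A -> k \in A -> nb A z = k |: nb A k ->
  cs A' + cs B' + delta i = cs A + cs B + delta z ->
  (cs A + cs B) i = 2 -> (cs A + cs B) j = 2 -> adj z i -> adj z j -> i = j.
Proof.
move=> cA cB cA' cB' zB zA kA nbz em /double_mem/andP[iA iB] /double_mem/andP[jA jB] zi zj.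
apply/eqP; apply: contraT => ij.
have sym x y : adj x y -> adj y x by rewrite adj_sym.
have nbP x : x \in A -> adj z x -> x != k -> adj k x.
  move=> xA zx xk; have : x \in nb A z by rewrite inE xA.
  by rewrite nbz !inE (negbTE xk) xA.
have zk : adj z k by have : k \in nb A z; [rewrite nbz !inE eqxx|rewrite inE kA].
have ik : i != k.
  apply: contraNneq ij => ik; apply/eqP; apply/eqP; apply: contraT => ij.
  case: (ce_triangle cB zB iB jB zi _ zj).
  by rewrite ik; apply: nbP => //; rewrite -ik eq_sym.
have jk : j != k.
  apply: contraNneq ij => jk; apply/eqP; apply/eqP; apply: contraT => ij.
  case: (ce_triangle cB zB jB iB zj _ zi).
  by rewrite jk; apply: nbP => //; rewrite -jk.
have card2 (x y u : T) C N g c : cycle_enum adj C N g -> c \in C -> x \in nb C c ->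
    y \in nb C c -> x != y -> u \in nb C c -> (u == x) || (u == y).
  move=> cC cC' xc yc xy uc; have := ce_card cC cC'.
  rewrite (cardsD1 x) xc (cardsD1 y) !inE eq_sym xy.
  move: yc; rewrite inE => -> /= [] /eqP; rewrite cards_eq0 => /eqP/setP/(_ u).
  by rewrite !inE; move: uc; rewrite inE => ->; case: (u == x) (u == y) => [] [].
have kB : k \notin B.
  apply/negP => kB; have := card2 i j k _ _ _ _ cB zB.
  rewrite !inE iB jB kB zi zj zk => /(_ isT isT ij isT).
  by rewrite ![k == _]eq_sym (negbTE ik) (negbTE jk).
have kz : k != z by apply: contraNneq zA => <-.
have m'z : ((z \in A') + (z \in B') = 2)%N.
  have := hopE z em; rewrite !csE eqxx zB (negbTE zA).
  by case: eqP zi => [->|_ _]; [rewrite adj_irr|rewrite addn0].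
have /andP[zA' zB'] : (z \in A') && (z \in B').
  by move: m'z; case: (z \in A') (z \in B') => [] [].
have kAB : (k \in A') || (k \in B').
  have := hopE k em; rewrite !csE kA (negbTE kB) (negbTE ik) eq_sym (negbTE kz).
  by case: (k \in A') (k \in B') => [] [].
(* The hop brings in no vertex but [z], so [x] lies in [A] or [B]; a neighbour of [z] in [B] is [i]
   or [j], and these lie in [A] as well. *)
have supp x : (x \in A') || (x \in B') -> adj z x -> x = k \/ adj k x.
  move=> xAB zx; have [|xk] := eqVneq x k; [by left|right].
  have : (0 < (x \in A) + (x \in B))%N.
    have zx' : (z == x) = false by apply/eqP => e; rewrite e adj_irr in zx.
    have := hopE x em; rewrite !csE zx' addn0 => <-; apply: ltn_addr.
    by move: xAB; case: (x \in A') (x \in B') => [] [].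
  case: (boolP (x \in A)) => [xA _|_]; first exact: nbP.
  case: (boolP (x \in B)) => // xB _.
  have := card2 i j x _ _ _ _ cB zB.
  rewrite !inE iB jB xB zi zj zx => /(_ isT isT ij isT)/orP[]/eqP->; exact: nbP.
(* The second neighbour of [z] in such a cycle would form a triangle with [z] and [k]. *)
have tri C N g : cycle_enum adj C N g -> z \in C -> k \in C ->
    (forall x, x \in C -> (x \in A') || (x \in B')) -> False.
  move=> cC zC kC sC; have := ce_card cC zC; rewrite (cardsD1 k) inE kC zk => -[] /eqP.
  case/cards1P => x /setP/(_ x); rewrite !inE eqxx => /and3P[xk xC zx].
  case: (supp x (sC x xC) zx) => [e|kx]; first by rewrite e eqxx in xk.
  exact: (ce_triangle cC zC kC xC zk kx zx).
case/orP: kAB => kC; [case: (tri _ _ _ cA' zA' kC)|case: (tri _ _ _ cB' zB' kC)] => x ->//.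
by rewrite orbT.
Qed.

(** * Two families of holes *)

Section Holes.
Hypothesis holeF : forall A, A \in F -> exists N g, cycle_enum adj A N g.
Hypothesis holeG : forall B, B \in G -> exists N g, cycle_enum adj B N g.

(** The hop at [z] ends at some doubled neighbour [l], and [no_double_hop] identifies every doubled
    neighbour with [l]. As [m z = 1], [z] lies in exactly one of [A] and [B]; the two cases differ
    by exchanging the families. *)
Lemma top_double_uniq m z i j : top_graded m -> m z = 1 -> odd (deg m z) ->
  m i = 2 -> m j = 2 -> adj z i -> adj z j -> i = j.
Proof.
move=> tm mz oz mi mj zi zj.
have [m' [l [em ml zl [Om' _]]]] := top_graded_hop tm mz oz.
have [A [B [AF BG eAB _]]] := graded_comm_pair tm.1.
have [A' [B' [A'F B'G eAB' _]]] := graded_comm_pair Om'.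
have [NA [gA cA]] := holeF AF; have [NB [gB cB]] := holeG BG.
have [NA' [gA' cA']] := holeF A'F; have [NB' [gB' cB']] := holeG B'G.
suff key x : m x = 2 -> adj z x -> l = x by rewrite -(key i) // (key j).
move=> mx zx; rewrite -eAB -?eAB' in em mz mx ml oz.
rewrite degD !deg_cs oddD in oz.
move: mz; rewrite csE; case: (boolP (z \in A)) => zA; case: (boolP (z \in B)) => zB // _.
  rewrite (negbTE (fam_even FF AF zA)) /= in oz.
  have zV := subsetP (fam_sub FF AF) _ zA.
  have [k kB [ek _ _]] := fam_move FG BG zV zB oz.
  apply: (no_double_hop cB cA cB' cA' zA zB kB ek _ _ _ zl zx).
  - by rewrite [cs B' + _]addrC [cs B + _]addrC.
  - by rewrite addrC.
  - by rewrite addrC.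
rewrite (negbTE (fam_even FG BG zB)) addbF in oz.
have zV := subsetP (fam_sub FG BG) _ zB.
have [k kA [ek _ _]] := fam_move FF AF zV zA oz.
exact: (no_double_hop cA cB cA' cB' zB zA kA ek em ml mx zl zx).
Qed.

Lemma double_even m x : graded_comm m != 0 -> m x = 2 -> ~~ odd (deg m x).
Proof.
move=> /graded_comm_pair[A [B [AF BG <- _]]] /double_mem/andP[xA xB].
by rewrite degD !deg_cs oddD (negbTE (fam_even FF AF xA)) (negbTE (fam_even FG BG xB)).
Qed.

(** * Hops propagating along one hole *)

Section Chain.
Variables (m : {ffun T -> nat}) (A B : {set T}) (N : nat).
Hypotheses (top_m : top_graded m) (m_eq : cs A + cs B = m).

Lemma mem_single_double x : x \in B -> m x = 1 \/ m x = 2.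
Proof. by rewrite -m_eq csE => ->; case: (x \in A); [right|left]. Qed.

(* m1 comes from m by hops along g 0, ..., g u.-1, so it still agrees with m beyond g u. *)
Lemma chain_step g m1 u : cycle_enum adj B N g -> m (g 0%N) = 1 ->
  ~~ odd u -> (u.+1 < N)%N -> top_graded m1 ->
  m1 (g u) = 1 -> odd (deg m1 (g u)) ->
  (forall t, (u < t < N)%N -> m1 (g t) = m (g t)) ->
  (forall x, m1 x = 2 -> x \in B) ->
  (forall t, ~~ odd t -> (u < t < N)%N -> odd (deg m1 (g t)) = odd (deg m (g t))) ->
  (forall i, m1 i = 2 -> adj (g u) i -> i = g u.+1) ->
  [/\ m (g u.+1) = 2, m (g u.+2) = 1 & exists m2,
   [/\ top_graded m2, m2 (g u.+1) = 1,
       forall t, (u.+1 < t < N)%N -> m2 (g t) = m (g t),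
       forall x, m2 x = 2 -> x \in B
     & forall t, ~~ odd t -> (u.+1 < t < N)%N ->
         odd (deg m2 (g t)) = odd (deg m (g t)) (+) (t == u.+2)]].
Proof.
move=> cB m0 eu uN top1 m1u ou m1t dB m1deg uniq.
have [m2 [i [e mi ui top2]]] := top_graded_hop top1 m1u ou.
have ei := uniq i mi ui; subst i.
have val y := hopE y e; have dg y := hop_deg y e.
have neq s t : (s < t < N)%N -> (g s == g t) = false.
  by move=> st; apply/negbTE/(ce_neq cB); lia.
have mu1 : m (g u.+1) = 2 by rewrite -m1t //; lia.
have m2u1 : m2 (g u.+1) = 1.
  have := val (g u.+1); rewrite eqxx mi neq; last lia.
  by rewrite addn0 addn1 => -[].
have m2u : m2 (g u) = 2.
  have := val (g u); rewrite eqxx m1u [_ == g u]eq_sym neq; last lia.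
  by rewrite addn0 addn1.
have m2t t : (u.+1 < t < N)%N -> m2 (g t) = m (g t).
  move=> ut; have := val (g t); rewrite !neq ?addn0 => [->| |]; try lia.
  by rewrite m1t //; lia.
have o2 : odd (deg m2 (g u.+1)).
  have := dg (g u.+1); rewrite adj_irr addn0 adj_sym ui addn1 => ->.
  by rewrite /= double_even //; case: top1.
split=> //.
  have [uN2|uN2] := ltnP u.+2 N; last first.
    have -> : u.+2 = (0 + N)%N by have := ce_even cB; lia.
    by rewrite (ce_addN cB).
  case: (mem_single_double (ce_in cB u.+2)) => // mu2.
  (* If [g u.+2] were doubled, then [g u.+1], simple and of odd degree in [m2], would have two
     distinct doubled neighbours. *)
  have : g u = g u.+2.
    apply: (top_double_uniq top2 m2u1 o2 m2u); rewrite ?m2t //; try lia.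
      by rewrite adj_sym.
    by rewrite (ce_adj_lt cB) ?eqxx //; lia.
  by move/eqP; rewrite neq //; lia.
exists m2; split=> //.
  move=> x m2x; have := val x; rewrite m2x.
  have [<- _|_] := eqVneq (g u) x; first exact: (ce_in cB).
  have [<- _|_] := eqVneq (g u.+1) x; first exact: (ce_in cB).
  by rewrite !addn0 => /esym/dB.
move=> t et ut; have := congr1 odd (dg (g t)); rewrite !oddD !oddb.
(* Both [t] and [u] are even, so doubling [g u] does not affect [g t]; the loss of a copy of
   [g u.+1] flips the parity at [u.+2] only. *)
have -> : adj (g t) (g u) = false.
  by apply/negP => /(ce_odd cB); rewrite (negbTE eu) (negbTE et).
rewrite adj_sym (ce_adj_lt cB) // andFb orbF addbF m1deg //; last lia.
by move=> <-; rewrite -addbA addbb addbF.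
Qed.

(** The hop at [g 0] makes [g 1] simple and thereby turns the degree of [g 2] odd, so [g 2] hops in
    turn, to [g 3]; this repeats along the even indices as long as their degrees in [m] are even. *)
Lemma cycle_chain g s : cycle_enum adj B N g ->
  m (g 0%N) = 1 -> odd (deg m (g 0%N)) -> m (g 1%N) = 2 ->
  (s.*2.+1 < N)%N -> (forall j, (0 < j <= s)%N -> ~~ odd (deg m (g j.*2))) ->
  m (g s.*2.+1) = 2 /\ m (g s.*2.+2) = 1.
Proof.
move=> cB m0 o0 m1 sN ev.
suff : [/\ m (g s.*2.+1) = 2, m (g s.*2.+2) = 1 & exists m2,
   [/\ top_graded m2, m2 (g s.*2.+1) = 1,
       forall t, (s.*2.+1 < t < N)%N -> m2 (g t) = m (g t),
       forall x, m2 x = 2 -> x \in B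
     & forall t, ~~ odd t -> (s.*2.+1 < t < N)%N ->
         odd (deg m2 (g t)) = odd (deg m (g t)) (+) (t == s.*2.+2)]] by case.
elim: s sN ev => [|s IHs] sN ev.
  apply: (chain_step cB m0 _ _ top_m) => //.
    by move=> x; rewrite -m_eq => /double_mem/andP[].
  move=> i mi zi; apply/esym; apply: (top_double_uniq top_m m0 o0 m1 mi) => //.
  by rewrite (ce_adj_lt cB) //; have := ce_big cB; lia.
have [||mo me [m2 [top2 m2s m2t dB dg]]] := IHs.
- by move: sN; rewrite doubleS; lia.
- by move=> j js; apply: ev; lia.
rewrite doubleS; rewrite doubleS in sN.
have es : ~~ odd s.*2.+2 by rewrite /= negbK odd_double.
apply: (chain_step cB m0 es sN top2) => //.
- by rewrite m2t //; lia.
- rewrite dg //; last lia.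
  by rewrite eqxx addbT; have := ev s.+1; rewrite doubleS; apply; lia.
- by move=> t st; apply: m2t; lia.
- by move=> t et st; rewrite dg; [case: eqP; [lia|rewrite addbF]| |lia].
(* Of the two neighbours on the cycle, [g s.*2.+1] is simple after the previous hop, which leaves
   the next one. *)
move=> i mi si; have iB := dB i mi.
have : i \in nb B (g s.*2.+2) by rewrite inE iB.
rewrite (ce_nb cB) !inE => /orP[]/eqP // ei; move: mi.
have -> : i = g s.*2.+1.
  by rewrite ei -[RHS](ce_addN cB); congr g; have := ce_big cB; lia.
by rewrite m2s.
Qed.

(** A vertex where a chain of hops as in [cycle_chain] arrives: the chain starts at a simple vertex
    of odd degree and hops on at vertices of even degree. *)
Definition chain_pt i := exists g s,
  [/\ cycle_enum adj B N g, (s.*2.+1 < N)%N & i = g s.*2.+1] /\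
  [/\ m (g 0%N) = 1, odd (deg m (g 0%N)), m (g 1%N) = 2
    & forall j, (0 < j <= s)%N -> ~~ odd (deg m (g j.*2))].

Lemma chain_pt_double i : chain_pt i -> m i = 2.
Proof.
by move=> [g [s [[cB sN ->] [m0 o0 m1 ev]]]]; case: (cycle_chain cB m0 o0 m1 sN ev).
Qed.

Lemma chain_pt_nb i y : chain_pt i -> y \in nb B i -> m y = 1.
Proof.
move=> [g [s [[cB sN ->] [m0 o0 m1 ev]]]]; rewrite (ce_nb cB) !inE => /orP[]/eqP->.
  by case: (cycle_chain cB m0 o0 m1 sN ev).
have -> : g (s.*2.+1 + N.-1)%N = g s.*2.
  by rewrite -[RHS](ce_addN cB); congr g; have := ce_big cB; lia.
case: s sN ev => // s sN ev; rewrite doubleS in sN *.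
case: (cycle_chain (s := s) cB m0 o0 m1) => [|j js|//]; first lia.
by apply: ev; lia.
Qed.

(** Crossing [y] lengthens or shortens the chain by one step. The chain neither backs out over its
    start nor closes up there after a full turn, since its start has odd degree and [y] even
    degree. *)
Lemma chain_pt_step i y j : chain_pt i -> y \in B -> ~~ odd (deg m y) ->
  i \in nb B y -> j \in nb B y -> j != i -> chain_pt j.
Proof.
move=> [g [s [[cB sN ->] [m0 o0 m1 ev]]]] yB ey iy.
have big := ce_big cB; have evN := ce_even cB.
have : y \in nb B (g s.*2.+1) by move: iy; rewrite !inE yB adj_sym => /andP[].
rewrite (ce_nb cB) !inE => /orP[]/eqP ey'; rewrite {}ey' in ey *; last first.
  have e : g (s.*2.+1 + N.-1)%N = g s.*2.
    by rewrite -[RHS](ce_addN cB); congr g; lia.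
  rewrite e in ey *; case: s sN ev ey {iy e} => [|s] sN ev ey; first by rewrite o0 in ey.
  move=> jy ji; exists g, s; rewrite doubleS in sN ey jy ji *.
  split; last by split=> // k ks; apply: ev; lia.
  split=> //; first lia.
  have : j \in nb B (g s.*2.+2) by rewrite inE.
  rewrite (ce_nb cB) !inE (negbTE ji) /= => /eqP->.
  by rewrite -[RHS](ce_addN cB); congr g; lia.
have sN2 : (s.*2.+3 < N)%N.
  suff : s.*2.+2 != N by lia.
  by apply: contraNneq ey => ->; rewrite -[N]add0n (ce_addN cB).
move=> jy ji; exists g, s.+1; split.
  rewrite doubleS; split=> //.
  have : j \in nb B (g s.*2.+2) by rewrite inE.
  rewrite (ce_nb cB) !inE => /orP[]/eqP // ej.
  case/eqP: ji; rewrite ej -[RHS](ce_addN cB); congr g; lia.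
split=> // k ks; have [->|ks1] := eqVneq k s.+1; first by rewrite doubleS.
by apply: ev; lia.
Qed.

Definition chain_rel : rel T := fun i j => (j != i) &&
  [exists y in B, [&& ~~ odd (deg m y), i \in nb B y & j \in nb B y]].

(** Stated through [connect], hence independently of an enumeration: the doubled neighbours of
    simple vertices of odd degree, closed under crossing vertices of even degree. *)
Definition chain_set : {set T} := [set i | [exists z in B, exists j,
  [&& m z == 1, odd (deg m z), m j == 2, j \in nb B z & connect chain_rel j i]]].

Lemma chain_set_pt g i : cycle_enum adj B N g -> i \in chain_set -> chain_pt i.
Proof.
move=> cB; rewrite inE => /exists_inP[z zB /existsP[j /and5P[/eqP mz oz /eqP mj zj]]].
have [g' [cB' g0 g1]] := ce_orient cB zB zj.
have : chain_pt j.
  exists g', 0%N; split; split; rewrite ?g0 ?g1 //; last by case.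
  by have := ce_big cB; lia.
move=> pj /connectP[p]; elim: p j pj {mj zj g1} => [|x p IHp] j pj /=; first by move=> _ ->.
case/andP=> /andP[xj /exists_inP[y yB /and3P[ey jy xy]]]; apply: IHp.
exact: chain_pt_step pj yB ey jy xy xj.
Qed.

Lemma chain_set_odd g b : cycle_enum adj B N g -> b \in B ->
  odd #|nb chain_set b| = odd (deg m b).
Proof.
move=> cB bB; have pt := chain_set_pt cB.
have sub i : i \in chain_set -> i \in B.
  by move/pt/chain_pt_double; rewrite -m_eq => /double_mem/andP[].
have nbI i : i \in nb chain_set b -> [/\ i \in chain_set, m i = 2 & adj b i].
  by rewrite inE => /andP[iC bi]; split=> //; apply/chain_pt_double/pt.
(* A doubled [b] has even degree and no neighbour in [chain_set], whose elements have only simple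
   neighbours in [B]. *)
case: (mem_single_double bB) => mb; last first.
  rewrite (negbTE (double_even top_m.1 mb)).
  suff -> : nb chain_set b = set0 by rewrite cards0.
  apply/setP => i; rewrite [RHS]inE; apply/negP => /nbI[iC _ bi].
  have := @chain_pt_nb i b (pt i iC).
  by rewrite inE bB adj_sym bi => /(_ isT); rewrite mb.
(* A simple vertex of odd degree has a doubled neighbour by the hop, only one by [top_double_uniq],
   and that one starts a chain. *)
case: (boolP (odd (deg m b))) => [ob|eb].
  have [_ [i [_ mi bi _]]] := top_graded_hop top_m mb ob.
  have iB : i \in B by move: mi; rewrite -m_eq => /double_mem/andP[].
  suff -> : nb chain_set b = [set i] by rewrite cards1.
  apply/setP => j; rewrite inE; apply/idP/eqP => [/nbI[_ mj bj]|->].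
    exact: (top_double_uniq top_m mb ob).
  rewrite inE bi andbT inE; apply/exists_inP; exists b => //; apply/existsP; exists i.
  by rewrite mb mi ob !eqxx inE iB bi connect0.
(* Chains continue across a vertex [b] of even degree, so one neighbour in [chain_set] brings in
   both. *)
have [->|/set0Pn[i /[dup]ib /nbI[iC mi bi]]] := eqVneq (nb chain_set b) set0.
  by rewrite cards0.
suff -> : nb chain_set b = nb B b by rewrite (ce_card cB).
apply/setP => j; rewrite !inE; apply/andP/andP => -[jC bj]; split=> //.
  by apply: sub; rewrite inE.
have [->|ji] := eqVneq j i; first by move: iC; rewrite inE.
move: (iC); rewrite inE => /exists_inP[z zB /existsP[k /and5P[mz oz mk zk ki]]].
apply/exists_inP; exists z => //; apply/existsP; exists k.
rewrite mz oz mk zk (connect_trans ki) // connect1 // /chain_rel ji /=.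
by apply/exists_inP; exists b => //; rewrite eb !inE (sub i iC) jC bi bj.
Qed.

(* Each odd vertex of B has exactly one neighbour in chain_set, every other vertex of B has
   none or two, and each vertex of chain_set has two neighbours in B. *)
Lemma top_graded_even g : cycle_enum adj B N g -> ~~ odd (\sum_(b in B) #|nb A b|).
Proof.
move=> cB; have even2 (X : {set T}) : X \subset B -> ~~ odd (\sum_(i in X) #|nb B i|).
  move=> /subsetP XB; rewrite (eq_bigr (fun _ => 2)) => [|i /XB]; last exact: (ce_card cB).
  by rewrite sum_nat_const oddM andbF.
suff : ~~ odd (\sum_(b in B) deg m b).
  rewrite (eq_bigr (fun b => #|nb A b| + #|nb B b|)%N) => [|b _].
    by rewrite big_split oddD (negbTE (even2 B _)) // addbF.
  by rewrite -m_eq degD !deg_cs.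
rewrite -(odd_sum (fun b => chain_set_odd cB)) sum_nb_swap //; apply: even2.
apply/subsetP => i /(chain_set_pt cB)/chain_pt_double.
by rewrite -m_eq => /double_mem/andP[].
Qed.

End Chain.

Lemma comm_holes : comm (\sum_(A in F) w A) (\sum_(B in G) v B) = 0.
Proof.
apply: graded_comm_vanish => m Om top.
have [A [B [AF BG em c0]]] := graded_comm_pair Om.
have [N [g cB]] := holeG BG.
have := comm_wv_odd AF BG c0.
by rewrite (negbTE (top_graded_even (conj Om top) em cB)).
Qed.

End Holes.
End TwoFamilies.

End Charges.

(** * Independent sets and holes of a claw-free graph *)

Section Families.
Variables (T : finType) (adj : rel T) (R : pzRingType) (V : {set T}) (h : T -> R).
Hypothesis adj_sym : symmetric adj.
Hypothesis adj_irr : irreflexive adj.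
Hypothesis h_sign : forall x y, x \in V -> y \in V ->
  h x * h y = (-1) ^+ adj x y * (h y * h x).
Hypothesis claw_free : forall c x y z, c \in V -> x \in V -> y \in V -> z \in V ->
  x != y -> x != z -> y != z -> adj c x -> adj c y -> adj c z ->
  [|| adj x y, adj x z | adj y z].
Notation nb := (nb adj).

Definition independent (S : {set T}) := {in S &, forall x y, ~~ adj x y}.
Definition hmono (S : {set T}) : R := \prod_(x in S) h x.

Lemma hmono_sign (S : {set T}) (r : R) (s : T -> nat) :
  (forall x, x \in S -> h x * r = (-1) ^+ s x * (r * h x)) ->
  hmono S * r = (-1) ^+ (\sum_(x in S) s x)%N * (r * hmono S).
Proof.
move=> hS; rewrite /hmono; elim: (index_enum T) => [|x l IHl].
  by rewrite !big_nil expr0 !mul1r mulr1.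
by rewrite !big_cons; case: ifP => // xS; apply: signM; first exact: hS.
Qed.

Lemma hmono_pull (S : {set T}) x : x \in S ->
  (forall y, y \in S -> h y * h x = h x * h y) -> hmono S = h x * hmono (S :\ x).
Proof.
move=> xS cS; rewrite /hmono.
have : x \in index_enum T by rewrite mem_index_enum.
elim: (index_enum T) (index_enum_uniq T) => // y l IHl /= /andP[yl ul].
rewrite inE !big_cons !inE; have [exy _|yx /= xl] := eqVneq x y.
  subst y; rewrite xS /=; congr (_ * _); rewrite big_seq_cond [RHS]big_seq_cond.
  apply: eq_bigl => z; rewrite !inE; case: (boolP (z \in l)) => //= zl.
  by rewrite (_ : z != x) //; apply: contraNneq yl => <-.
rewrite IHl //; case: ifP => // yS; by rewrite mulrA cS // -mulrA.
Qed.

Lemma independent_comm (S : {set T}) x y : S \subset V -> independent S ->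
  x \in S -> y \in S -> h x * h y = h y * h x.
Proof.
move=> /subsetP SV iS xS yS.
by rewrite h_sign ?SV // (negbTE (iS x y xS yS)) expr0 mul1r.
Qed.

Lemma hmono_comm (S : {set T}) x : S \subset V -> x \in V -> ~~ odd #|nb S x| ->
  hmono S * h x = h x * hmono S.
Proof.
move=> /subsetP SV xV ev.
rewrite (@hmono_sign S (h x) (fun y => adj x y)) => [|y yS]; last first.
  by have yV := SV y yS; rewrite h_sign // adj_sym.
by rewrite -card_nb -signr_odd (negbTE ev) mul1r.
Qed.

(** Three neighbours of [x] in an independent set would form a claw with centre [x]. *)
Lemma nb_le2 (S : {set T}) x : S \subset V -> independent S -> x \in V ->
  (#|nb S x| <= 2)%N.
Proof.
move=> /subsetP SV iS xV; rewrite leqNgt; apply/card_gt2P => -[a [b [c []]]].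
rewrite !inE => -[/andP[aS xa] /andP[bS xb] /andP[cS xc]] [ab bc ca].
have := claw_free xV (SV a aS) (SV b bS) (SV c cS) ab _ bc xa xb xc.
rewrite (negbTE (iS a b aS bS)) (negbTE (iS a c aS cS)) (negbTE (iS b c bS cS)).
by rewrite eq_sym => /(_ ca).
Qed.

Lemma hmono_swap (S : {set T}) x y (r := hmono (S :\ y)) :
  S \subset V -> independent S -> x \in V -> x \notin S -> y \in S -> nb S x = [set y] ->
  [/\ hmono S = h y * r, hmono (x |: (S :\ y)) = h x * r,
      r * h x = h x * r & r * h y = h y * r].
Proof.
move=> SV iS xV xS yS nbx; have sub : S :\ y \subset V by apply: subset_trans SV; apply: subD1set.
have yV := subsetP SV _ yS.
have rx : r * h x = h x * r.
  apply: hmono_comm => //; rewrite (_ : nb _ x = set0) ?cards0 //.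
  apply/setP => z; move/setP: nbx => /(_ z); rewrite !inE.
  by case: (z == y) (z \in S) (adj x z) => [] [] [].
have ry : r * h y = h y * r.
  apply: hmono_comm => //; rewrite (_ : nb _ y = set0) ?cards0 //.
  apply/setP => z; rewrite !inE; case: (boolP (z \in S)) => [zS|]; last by rewrite andbF.
  by rewrite (negbTE (iS y z yS zS)) andbF.
split=> //; first by apply: hmono_pull => // z zS; apply: (independent_comm SV iS).
rewrite (@hmono_pull _ x) ?setU11 //.
  congr (_ * hmono _); apply/setP => z; rewrite !inE.
  by case: eqP => // ->; rewrite (negbTE xS) andbF.
move=> z; rewrite !inE => /orP[/eqP->//|/andP[zy zS]].
rewrite h_sign // ?(subsetP SV) //; move/setP: nbx => /(_ z).
by rewrite !inE zS (negbTE zy) adj_sym /= => ->; rewrite mul1r.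
Qed.

(** An odd number of neighbours in an independent set is one, by [nb_le2], and the move replaces
    that neighbour [y] by [x]. The factors [h x] and [h y] anticommute with each other and commute
    with the rest of the product. *)
Lemma independent_family (F : {set {set T}}) :
  (forall S, S \in F -> S \subset V /\ independent S) ->
  (forall S x y, S \in F -> x \in V -> x \notin S -> y \in S -> nb S x = [set y] ->
     x |: (S :\ y) \in F) ->
  charge_family adj V h F hmono.
Proof.
move=> indF closF.
have nb0 S x : S \in F -> x \in S -> nb S x = set0.
  move=> SF xS; have [_ iS] := indF S SF; apply/setP => y; rewrite !inE.
  by case: (boolP (y \in S)) => // yS; rewrite (negbTE (iS x y xS yS)).
split.
- by move=> S /indF[].
- by move=> S r s _; apply: hmono_sign.
- by move=> S x SF xS; rewrite nb0 // cards0.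
- move=> S x SF xV xS ox; have [SV iS] := indF S SF.
  have /cards1P[y nbx] : #|nb S x| == 1%N.
    by have := nb_le2 SV iS xV; case: #|_| ox => [|[|[]]].
  have [yS xy] : y \in S /\ adj x y.
    by have : y \in nb S x; [rewrite nbx inE|rewrite inE => /andP[]].
  exists y => //; split; first by rewrite (nb0 S y) // setU0.
    exact: closF.
  have [-> -> rx ry] := hmono_swap SV iS xV xS yS nbx.
  have yV := subsetP SV _ yS.
  by rewrite -!mulrA ry rx !mulrA (h_sign xV yV) xy mulN1r mulNr.
- by move=> S y z SF yS zS; rewrite !nb0 // !setU0 => /set1_inj.
Qed.

(** * Colour classes of an even hole, and exchanging one vertex *)

Definition colouring (A X : {set T}) :=
  [/\ X \subset A, independent X & independent (A :\: X)].

Section OneHole.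
Variables (A : {set T}) (N : nat) (g : nat -> T).
Hypotheses (cA : cycle_enum adj A N g) (AV : A \subset V).

Lemma colouring_compl X : colouring A X -> colouring A (A :\: X).
Proof.
case=> XA iX iY; split=> //; first exact: subsetDl.
by rewrite setDDr setDv set0U (setIidPr XA).
Qed.

Lemma colouring_adj X x y : colouring A X -> x \in A -> y \in A -> adj x y ->
  (y \in X) = (x \notin X).
Proof.
move=> [XA iX iY] xA yA xy; case: (boolP (x \in X)) => xX.
  by apply/negP => yX; have := iX x y xX yX; rewrite xy.
by apply: contraT => yX; have := iY x y; rewrite !inE xX yX xA yA xy => /(_ isT isT).
Qed.

Lemma colouring_ex : exists X, colouring A X.
Proof.
exists [set g t | t : 'I_N & odd t]; split.
- by apply/subsetP => x /imsetP[t _ ->]; apply: (ce_in cA).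
- move=> x y /imsetP[s + ->] /imsetP[t + ->]; rewrite !inE => os ot.
  by apply/negP => /(ce_odd cA); rewrite os ot.
- have ev x : x \in A :\: [set g t | t : 'I_N & odd t] -> exists2 t, ~~ odd t & x = g t.
    rewrite inE => /andP[no /(ce_lt cA)[t tN e]]; exists t => //.
    by apply: contra no => ot; rewrite e; apply/imsetP; exists (Ordinal tN); rewrite ?inE.
  move=> x y /ev[s es ->] /ev[t et ->].
  by apply/negP => /(ce_odd cA); rewrite (negbTE es) (negbTE et).
Qed.

(** Membership alternates along [g], so a colour class is determined by whether it contains
    [g 0]. *)
Lemma colouring_uniq X Y : colouring A X -> colouring A Y -> Y = X \/ Y = A :\: X.
Proof.
have par Z t : colouring A Z -> (g t \in Z) = (g 0%N \in Z) (+) odd t.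
  move=> cZ; elim: t => [|t IHt]; first by rewrite addbF.
  rewrite (colouring_adj (x := g t) cZ) ?(ce_in cA) ?IHt ?addbN //.
  by rewrite (ce_adj cA) eqxx.
move=> cX cY; have sub Z : colouring A Z -> {in [predC A], forall x, (x \in Z) = false}.
  by move=> [ZA _ _] x xA; apply/negbTE; apply: contra xA; apply: (subsetP ZA).
have [e|ne] := eqVneq (g 0%N \in X) (g 0%N \in Y); [left|right]; apply/setP => x.
  case: (boolP (x \in A)) => [/(ce_mem cA)[t ->]|xA]; last by rewrite !sub.
  by rewrite (par X t) // (par Y t) // e.
rewrite inE; case: (boolP (x \in A)) => [/(ce_mem cA)[t ->]|xA]; last by rewrite sub ?andbF.
rewrite (par X t) // (par Y t) // andbT; move: ne.
by case: (g 0%N \in X) (g 0%N \in Y) (odd t) => [] [] [].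
Qed.

Lemma nb_colouring X x : colouring A X -> x \in X -> nb (A :\: X) x = nb A x.
Proof.
move=> cX xX; have [XA _ _] := cX; apply/setP => y; rewrite !inE.
case: (boolP (y \in A)) => yA; rewrite ?andbF //= andbT.
case: (boolP (adj x y)) => xy; rewrite ?andbF // andbT.
by rewrite (colouring_adj cX _ yA xy) ?xX // (subsetP XA).
Qed.

(** Each [x] in [X] has two neighbours in the other class, so its signs cancel. *)
Lemma colouring_hmonoC X : colouring A X ->
  hmono X * hmono (A :\: X) = hmono (A :\: X) * hmono X.
Proof.
move=> cX; have [XA _ _] := cX; rewrite (@hmono_sign X _ (fun _ => 0%N)).
  by rewrite big1 // mul1r.
move=> x xX; have xA := subsetP XA _ xX; rewrite mul1r hmono_comm //.
- by apply: subset_trans AV; apply: subsetDl.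
- exact: (subsetP AV).
- by rewrite nb_colouring // (ce_card cA).
Qed.

Lemma colouring_hmono X Y : colouring A X -> colouring A Y ->
  hmono Y * hmono (A :\: Y) = hmono X * hmono (A :\: X).
Proof.
move=> cX cY; case: (colouring_uniq cX cY) => [->//|->].
have [XA _ _] := cX; rewrite setDDr setDv set0U (setIidPr XA).
by rewrite -colouring_hmonoC.
Qed.

(* x has at most two neighbours of each colour, hence exactly one, k, of some colour; claws at
   k and at the other neighbours of x force these to be the neighbours of k. *)
Lemma hole_move x : x \in V -> x \notin A -> odd #|nb A x| ->
  exists2 y, y \in A & nb A x = y |: nb A y.
Proof.
move=> xV xA ox; have [X0 cX0] := colouring_ex.
have splitX X : colouring A X -> nb A x = nb X x :|: nb (A :\: X) x.
  move=> [/subsetP XA _ _]; apply/setP => y; rewrite !inE.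
  by case: (boolP (y \in X)) => [/XA->|]; rewrite ?orbF //= orbC.
have subV X : colouring A X -> X \subset V /\ A :\: X \subset V.
  by move=> [XA _ _]; split; apply: subset_trans AV; rewrite ?subsetDl.
have card_nb X : colouring A X -> #|nb A x| = (#|nb X x| + #|nb (A :\: X) x|)%N.
  move=> cX; rewrite (splitX X cX) cardsU (_ : _ :&: _ = set0) ?cards0 ?subn0 //.
  by apply/setP => y; rewrite !inE; case: (y \in X); rewrite ?andbF.
have [X cX /cards1P[k nbX]] : exists2 X, colouring A X & #|nb X x| == 1%N.
  have [sX sY] := subV _ cX0; have [XA iX iY] := cX0.
  move: ox (nb_le2 sX iX xV) (nb_le2 sY iY xV); rewrite (card_nb _ cX0).
  move=> o le1 le2; have /orP[e|e] : (#|nb X0 x| == 1%N) || (#|nb (A :\: X0) x| == 1%N) by lia.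
    by exists X0.
  by exists (A :\: X0) => //; apply: colouring_compl.
have [sX sY] := subV _ cX; have [XA iX iY] := cX.
have [kX xk] : k \in X /\ adj x k.
  by have : k \in nb X x; [rewrite nbX inE|rewrite inE => /andP[]].
have kA := subsetP XA _ kX; have kV := subsetP AV _ kA.
exists k => //; rewrite (splitX X cX) nbX; congr (_ |: _).
(* Candidate claw with centre [a] and leaves [x], [u], [v]: the last two are not adjacent, since an
   even cycle has no triangle. *)
have claw a u v : a \in A -> u \in nb A a -> v \in nb A a -> u != v -> adj x a ->
    adj x u || adj x v.
  move=> aA; rewrite !inE => /andP[uA au] /andP[vA av] uv xa.
  have AV' := subsetP AV.
  have := claw_free (AV' a aA) xV (AV' u uA) (AV' v vA) _ _ uv _ au av.
  rewrite adj_sym xa; case: (boolP (adj u v)) => [uv'|_].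
    by case: (ce_triangle cA aA uA vA au uv' av).
  rewrite orbF; apply=> //; by apply: contraNneq xA => ->.
have two a : a \in A -> exists u v, [/\ u \in nb A a, v \in nb A a & u != v].
  move=> aA; have /cards2P[u [v [uv ->]]] : #|nb A a| == 2 by rewrite (ce_card cA).
  by exists u, v; rewrite !inE !eqxx orbT.
have subk : nb (A :\: X) x \subset nb A k.
  apply/subsetP => a; rewrite !inE => /andP[/andP[aX aA] xa]; rewrite aA /=.
  have [u [v [ua va uv]]] := two a aA.
  have inX z : z \in nb A a -> adj x z -> adj k a.
    rewrite inE => /andP[zA az] xz; have zX : z \in X.
      by rewrite (colouring_adj cX aA zA az).
    have : z \in nb X x by rewrite inE zX.
    by rewrite nbX inE => /eqP <-; rewrite adj_sym.
  by case/orP: (claw a u v aA ua va uv xa); apply: inX.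
apply/eqP; rewrite eqEcard subk (ce_card cA kA) /=.
(* [nb A k] has two elements, so two neighbours of the other colour are needed: the claw condition
   at [k] gives one, parity a second. *)
have nz : (0 < #|nb (A :\: X) x|)%N.
  have [u [v [uk vk uv]]] := two k kA; apply/card_gt0P.
  have inY z : z \in nb A k -> adj x z -> z \in nb (A :\: X) x.
    by rewrite -(nb_colouring cX kX) !inE => /andP[/andP[-> ->] _] ->.
  by case/orP: (claw k u v kA uk vk uv xk) => ?; [exists u|exists v]; apply: inY.
by move: ox nz; rewrite (card_nb _ cX) nbX cards1; case: #|_| => [|[]].
Qed.

End OneHole.

(** In the class [X] of [y] the vertex [x] has [y] as its only neighbour, so [hmono_swap] applies
    there. The product over the other class commutes with [h x] and [h y], because [x] and [y] have
    two neighbours each in it. *)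
Lemma hole_family (F : {set {set T}}) (w : {set T} -> R) :
  (forall A, A \in F -> A \subset V /\ exists N g, cycle_enum adj A N g) ->
  (forall A X, A \in F -> colouring A X -> w A = hmono X * hmono (A :\: X)) ->
  (forall A x y, A \in F -> x \in V -> x \notin A -> y \in A -> nb A x = y |: nb A y ->
     x |: (A :\ y) \in F) ->
  charge_family adj V h F w.
Proof.
move=> holeF wF closF; split.
- by move=> A /holeF[].
- move=> A r s AF hs; have [AV [N [g cA]]] := holeF A AF.
  have [X cX] := colouring_ex cA; have [XA _ _] := cX; rewrite (wF A X) //.
  rewrite (big_setID X) /= (setIidPr XA); apply: signM; apply: hmono_sign => x.
    by move=> xX; apply: hs; apply: (subsetP XA).
  by rewrite inE => /andP[_]; apply: hs.
- by move=> A x AF xA; have [_ [N [g cA]]] := holeF A AF; rewrite (ce_card cA).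
- move=> A x AF xV xA ox; have [AV [N [g cA]]] := holeF A AF.
  have [y yA nbx] := hole_move cA AV xV xA ox.
  have A'F := closF A x y AF xV xA yA nbx.
  exists y => //; split=> //.
  have xy : adj x y by have : y \in nb A x; [rewrite nbx setU11|rewrite inE yA].
  have [X cX yX] : exists2 X, colouring A X & y \in X.
    have [X cX] := colouring_ex cA; case: (boolP (y \in X)) => yX; first by exists X.
    by exists (A :\: X); [apply: colouring_compl|rewrite inE yX].
  have [XA iX iY] := cX; have xX : x \notin X by apply: contra xA; apply: (subsetP XA).
  have XV := subset_trans XA AV.
  have nbX : nb X x = [set y].
    apply/setP => z; rewrite !inE; apply/andP/eqP => [[zX xz]|->]; last by [].
    have : z \in nb A x by rewrite inE xz (subsetP XA).
    rewrite nbx !inE => /orP[/eqP//|/andP[_ yz]].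
    by have := iX y z yX zX; rewrite yz.
  have nbY : nb (A :\: X) x = nb A y.
    rewrite -(nb_colouring cX yX); apply/setP => z; move/setP: nbx => /(_ z); rewrite !inE.
    case: (z =P y) => [->|_]; first by rewrite yX.
    by case: (z \in A) (z \in X) (adj x z) (adj y z) => [] [] [] [].
  have cX' : colouring (x |: (A :\ y)) (x |: (X :\ y)).
    split; first by apply: setUS; apply: setSD.
    - move=> a b; rewrite !inE => /orP[/eqP->|/andP[ay aX]] /orP[/eqP->|/andP[yb bX]].
      + by rewrite adj_irr.
      + by apply: contra yb => xb; have : b \in nb X x; [rewrite inE bX|rewrite nbX inE].
      + by rewrite adj_sym; apply: contra ay => xa; have : a \in nb X x;
          [rewrite inE aX|rewrite nbX inE].
      + exact: iX.
    - move=> a b; rewrite !inE => /andP[+ +] /andP[+ +].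
      have inY c : ~~ ((c == x) || (c != y) && (c \in X)) -> (c == x) || (c != y) && (c \in A) ->
          c \in A :\: X.
        by rewrite inE; case: (c == x) (c == y) (c \in X) (c \in A) => [] [] [] [].
      by move=> a1 a2 b1 b2; apply: iY; apply: inY.
  have eY : (x |: (A :\ y)) :\: (x |: (X :\ y)) = A :\: X.
    apply/setP => z; rewrite !inE; case: (z =P x) => [->|_]; first by rewrite /= (negbTE xA) andbF.
    by case: (z =P y) => [->|_] //=; rewrite yX.
  have [eX eX' rx ry] := hmono_swap XV iX xV xX yX nbX.
  have DV : A :\: X \subset V by apply: subset_trans AV; apply: subsetDl.
  have yV := subsetP AV _ yA.
  have cYx : hmono (A :\: X) * h x = h x * hmono (A :\: X).
    by apply: hmono_comm; rewrite // nbY (ce_card cA).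
  have cYy : hmono (A :\: X) * h y = h y * hmono (A :\: X).
    by apply: hmono_comm; rewrite // (nb_colouring cX) // (ce_card cA).
  rewrite (wF _ _ A'F cX') (wF _ _ AF cX) eY eX eX' -!mulrA cYx cYy.
  rewrite !(mulrA (hmono (X :\ y))) rx ry -!mulrA !(mulrA (h _) (h _)).
  by rewrite (h_sign xV yV) xy mulN1r mulNr.
(* Distinct twins in a hole would be adjacent and share a further neighbour, giving a triangle. *)
- move=> A y z AF yA zA e; have [AV [N [g cA]]] := holeF A AF.
  apply/eqP; apply: contraT => yz.
  have yz' : adj y z.
    by move/setP: e => /(_ z); rewrite !inE eqxx zA eq_sym (negbTE yz).
  have := ce_card cA yA; rewrite (cardsD1 z) inE zA yz' => -[] /eqP/cards1P[u /setP/(_ u)].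
  rewrite !inE eqxx => /and3P[uz uA yu].
  have : u \in z |: nb A z by rewrite -e !inE uA yu orbT.
  rewrite !inE (negbTE uz) uA /= => zu.
  by case: (ce_triangle cA yA zA uA yz' zu yu).
Qed.

End Families.

(** * Pauli strings *)

Section PauliFacts.
Variables (C : numClosedFieldType) (n : nat).
Implicit Types p q : pauli_string n.

Lemma qbit_inj (l x y : nat) : (x < 2 ^ l)%N -> (y < 2 ^ l)%N ->
  (forall k, (k < l)%N -> qbit k x = qbit k y) -> x = y.
Proof.
elim: l x y => [|l IHl] x y; first by rewrite !ltnS !leqn0 => /eqP-> /eqP->.
move=> lx ly e; have e0 := e 0%N isT; rewrite /qbit !divn1 in e0.
rewrite -[x]odd_double_half -[y]odd_double_half e0; congr (_ + _.*2)%N.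
apply: IHl => [||k kl]; rewrite -!divn2.
- by rewrite ltn_divLR // mulnC -expnS.
- by rewrite ltn_divLR // mulnC -expnS.
- by have := e k.+1 kl; rewrite /qbit !expnS !divnMA.
Qed.

Definition bits (x : 'I_(2 ^ n)) : {ffun 'I_n -> bool} := [ffun k : 'I_n => qbit k x].

Lemma bits_inj : injective bits.
Proof.
move=> x y /ffunP e; apply: val_inj.
apply: (qbit_inj (ltn_ord x) (ltn_ord y)) => k kn.
by have := e (Ordinal kn); rewrite !ffunE.
Qed.

Lemma bits_bij : bijective bits.
Proof. by apply: (inj_card_bij bits_inj); rewrite card_ffun card_bool !card_ord. Qed.

(** The middle index runs over bit strings, and the sum over them distributes over the qubits: a
    product of tensor products is the tensor product of the products. *)
Lemma pauli_mxM p q x y : (pauli_mx C p *m pauli_mx C q) x y =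
  \prod_(k < n) \sum_(c : bool) pauli1 C (p k) (qbit k x) c * pauli1 C (q k) c (qbit k y).
Proof.
rewrite bigA_distr_bigA (reindex bits) /=; last exact/onW_bij/bits_bij.
rewrite mxE; apply: eq_bigr => z _; rewrite !mxE -big_split.
by apply: eq_bigr => k _; rewrite ffunE.
Qed.

Lemma pauli1_sqr (a : 'I_4) r t :
  \sum_(c : bool) pauli1 C a r c * pauli1 C a c t = (r == t)%:R.
Proof.
have i2 : 'i * 'i = -1 :> C by rewrite -expr2 sqrCi.
rewrite big_bool; case: a => [[|[|[|[|]]]] //= ?]; case: r; case: t;
  rewrite /pauli1 /= ?mulr0 ?mul0r ?mulr1 ?addr0 ?add0r ?mulrN ?mulNr ?i2 ?opprK ?mulr1 //.
Qed.

Definition anti1 (a b : 'I_4) : bool := [&& val a != 0%N, val b != 0%N & a != b].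

Lemma pauli1C (a b : 'I_4) r t :
  \sum_(c : bool) pauli1 C a r c * pauli1 C b c t =
  (-1) ^+ anti1 a b * \sum_(c : bool) pauli1 C b r c * pauli1 C a c t.
Proof.
rewrite !big_bool; case: a => [[|[|[|[|]]]] //= ?]; case: b => [[|[|[|[|]]]] //= ?];
  rewrite /anti1 -?val_eqE /= ?expr0 ?expr1; case: r; case: t; rewrite /pauli1 /=; ring.
Qed.

Lemma pauli_mx_sqr p : pauli_mx C p *m pauli_mx C p = 1%:M.
Proof.
apply/matrixP => x y; rewrite pauli_mxM [RHS]mxE; under eq_bigr do rewrite pauli1_sqr.
have [->|xy] := eqVneq x y; first by rewrite big1 // => k _; rewrite eqxx.
suff [k nk] : exists k : 'I_n, qbit k x != qbit k y.
  by rewrite (bigD1 k) //= (negbTE nk) mul0r.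
apply/existsP; apply: contraNT xy; rewrite negb_exists => /forallP e.
by apply/eqP/bits_inj/ffunP => k; rewrite !ffunE; apply/eqP; have := e k; rewrite negbK.
Qed.

Lemma pauli_mxC p q : exists s : bool,
  pauli_mx C p *m pauli_mx C q = (-1) ^+ s *: (pauli_mx C q *m pauli_mx C p).
Proof.
exists (odd (\sum_(k < n) anti1 (p k) (q k))).
apply/matrixP => x y; rewrite [RHS]mxE !pauli_mxM signr_odd expr_sum -big_split.
by apply: eq_bigr => k _; rewrite pauli1C.
Qed.

End PauliFacts.

(** * The Pauli Hamiltonian and its charges as charge families *)

Section Assembly.
Variables (C : numClosedFieldType) (n : nat).
Variables (V : {set pauli_string n}) (b : pauli_string n -> C).
Hypothesis b_neq0 : forall j, j \in V -> b j != 0.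

Notation h := (hterm b).
Notation adj := (frust V b).

Lemma mx_two_reg (A : 'M[C]_(2 ^ n)) : A + A = 0 -> A = 0.
Proof.
rewrite -mulr2n -scaler_nat => /eqP; rewrite scaler_eq0 pnatr_eq0 /=.
by move/eqP.
Qed.

Lemma hterm_sqr j : h j *m h j = (b j ^+ 2)%:M.
Proof. by rewrite -scalemxAl -scalemxAr pauli_mx_sqr scalerA -expr2 scalemx1. Qed.

Lemma hterm_reg j (A : 'M[C]_(2 ^ n)) : j \in V -> A *m h j = 0 -> A = 0.
Proof.
move=> jV /(congr1 (mulmx^~ (h j))); rewrite mul0mx -mulmxA hterm_sqr mul_mx_scalar.
by move/eqP; rewrite scaler_eq0 expf_eq0 (negbTE (b_neq0 jV)) /= => /eqP.
Qed.

Lemma frust_sym : symmetric adj.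
Proof.
move=> j k; rewrite /frust; case: (j \in V) (k \in V) => [] [] //=.
by rewrite -eqr_oppLR eq_sym.
Qed.

(** A term anticommuting with itself would have square zero, but the square is [b j ^+ 2] times the
    identity, with [b j] nonzero. *)
Lemma frust_irr : irreflexive adj.
Proof.
move=> j; rewrite /frust; case: (boolP (j \in V)) => //= jV.
apply/negbTE/eqP => /eqP; rewrite -subr_eq0 opprK => /eqP/mx_two_reg/(hterm_reg jV) hj.
have := hterm_sqr j; rewrite hj mul0mx => /esym/eqP.
have -> : (b j ^+ 2)%:M = b j ^+ 2 *: (1%:M : 'M[C]_(2 ^ n)) by rewrite scalemx1.
rewrite scaler_eq0 expf_eq0 (negbTE (b_neq0 jV)) /= => /eqP/matrixP.
have lt : (0 < 2 ^ n)%N by rewrite expn_gt0.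
by move/(_ (Ordinal lt) (Ordinal lt))/eqP; rewrite !mxE eqxx oner_eq0.
Qed.

Lemma hterm_sign j k : j \in V -> k \in V ->
  h j * h k = (-1) ^+ adj j k * (h k * h j).
Proof.
move=> jV kV; have [s e] := pauli_mxC C j k.
have {}e : h j * h k = (-1) ^+ s *: (h k * h j).
  rewrite -!mulmxE -!scalemxAl -!scalemxAr e !scalerA.
  by congr (_ *: _); ring.
rewrite /frust jV kV !mulmxE /=; case: eqP => [->|ne]; first by rewrite expr1 mulN1r.
by case: s e => e; [case: ne; rewrite e expr1 scaleN1r|rewrite e expr0 scale1r mul1r].
Qed.

Lemma indepP (S : {set pauli_string n}) :
  reflect (S \subset V /\ independent adj S) (indep V b S).
Proof.
apply: (iffP andP) => -[SV].
  move=> /'forall_implyP iS; split=> // x y xS yS.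
  by have /'forall_implyP := iS x xS; apply.
by move=> iS; split=> //; apply/forall_inP => x xS; apply/forall_inP => y yS; apply: iS.
Qed.

Lemma hprodE S : hprod b S = hmono h S.
Proof. by rewrite /hprod /hmono mulmxE. Qed.

(** The finite enumeration in [even_hole] becomes periodic by reducing indices modulo [#|A|];
    conversely the period is [#|A|], because [g] is injective below it. *)
Lemma even_holeP (A : {set pauli_string n}) :
  reflect (A \subset V /\ exists N g, cycle_enum adj A N g) (even_hole V b A).
Proof.
apply: (iffP and4P) => [[big ev AV /existsP[f /andP[/andP[]]]]|].
  move=> /injectiveP finj /eqP eA /forallP fadj.
  split=> //; exists #|A|.
  have pos : (0 < #|A|)%N by apply: leq_trans big.
  pose o t := Ordinal (ltn_pmod t pos); exists (fun t => f (o t)); split=> //.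
  - by move=> s t; rewrite (inj_eq finj).
  - move=> s t; have /forallP/(_ (o t))/eqP -> := fadj (o s).
    rewrite /= -[((s %% #|A|)%N.+1)%N]addn1 -[((t %% #|A|)%N.+1)%N]addn1 !modnDml !addn1.
    by rewrite [_ == (s.+1 %% _)%N]eq_sym [_ == (t.+1 %% _)%N]eq_sym.
  move=> x; rewrite [in X in X <-> _]eA; split.
    case/imsetP => i _ ->; exists i; congr (f _); apply: val_inj.
    by rewrite /= modn_small.
  by case=> t ->; apply: imset_f.
move=> [AV [N [g cA]]]; have [big ev eqg adjg memg] := cA.
have eA : A = [set g i | i : 'I_N].
  apply/setP => x; apply/idP/imsetP => [/(ce_lt cA)[t tN ->]|[i _ ->]]; last exact: (ce_in cA).
  by exists (Ordinal tN).
have eN : #|A| = N.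
  rewrite {1}eA card_imset ?card_ord // => s t /eqP; rewrite eqg !modn_small // => /eqP.
  exact: val_inj.
rewrite eN; split=> //; apply/existsP; exists [ffun i : 'I_N => g i].
apply/andP; split; first (apply/andP; split).
- apply/injectiveP => s t; rewrite !ffunE => /eqP; rewrite eqg.
  by rewrite !modn_small // => /eqP/val_inj.
- by rewrite {1}eA; apply/eqP; apply: eq_imset => i; rewrite ffunE.
apply/forallP => s; apply/forallP => t; rewrite !ffunE adjg.
rewrite (modn_small (ltn_ord s)) (modn_small (ltn_ord t)).
by rewrite [_ == nat_of_ord t]eq_sym [_ == nat_of_ord s]eq_sym.
Qed.

Section ClawFree.
Hypothesis claw : claw_free V b.

Lemma frust_claw c x y z : c \in V -> x \in V -> y \in V -> z \in V ->
  x != y -> x != z -> y != z -> adj c x -> adj c y -> adj c z ->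
  [|| adj x y, adj x z | adj y z].
Proof.
move=> cV xV yV zV xy xz yz cx cy cz.
have neq u : adj c u -> c != u by apply: contraTneq => <-; rewrite frust_irr.
by apply: (claw cV); rewrite ?neq.
Qed.

Lemma ts_component s (S0 S : {set pauli_string n}) : indep V b S0 -> #|S0| = s ->
  connect (ts_edge V b s) S0 S -> indep V b S /\ #|S| = s.
Proof.
move=> iS0 cS0 /connectP[p]; elim: p S0 iS0 cS0 => [|S1 p IHp] S0 iS0 cS0 /=; first by move=> _ ->.
by move=> /andP[/and5P[_ iS1 _ /eqP cS1 _]]; apply: IHp.
Qed.

Definition ts_family s (S0 : {set pauli_string n}) :=
  [set S | connect (ts_edge V b s) S0 S].

Lemma ts_familyP s S0 S : indep V b S0 -> #|S0| = s -> S \in ts_family s S0 ->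
  [/\ S \subset V, independent adj S & #|S| = s].
Proof.
by move=> iS0 cS0; rewrite inE => /(ts_component iS0 cS0)[/indepP[SV iS] cS]; split.
Qed.

(** Replacing the only neighbour of [x] in [S] by [x] is a token slide, so it stays in the
    component. *)
Lemma ts_charge_family s S0 : indep V b S0 -> #|S0| = s ->
  charge_family adj V h (ts_family s S0) (hmono h).
Proof.
move=> iS0 cS0; apply: independent_family.
- exact: frust_sym.
- exact: hterm_sign.
- exact: frust_claw.
- by move=> S /(ts_familyP iS0 cS0)[].
move=> S x y SF xV xS yS nbx; have [SV iS cS] := ts_familyP iS0 cS0 SF.
move: SF; rewrite !inE => SF; apply: connect_trans SF (connect1 _).
have xy : adj x y by have : y \in nb adj S x; [rewrite nbx inE|rewrite inE => /andP[]].
have yx : y != x by apply: contraNneq xS => <-.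
have xN z : z \in S -> z != y -> ~~ adj x z.
  move=> zS zy; apply: contraNN zy => xz; have : z \in nb adj S x by rewrite inE zS.
  by rewrite nbx inE.
apply/and5P; split.
- by apply/indepP.
- apply/indepP; split.
    by rewrite subUset sub1set xV (subset_trans _ SV) ?subD1set.
  move=> u v; rewrite !inE => /orP[/eqP->|/andP[uy uS]] /orP[/eqP->|/andP[vy vS]].
  + by rewrite frust_irr.
  + exact: xN.
  + by rewrite frust_sym; apply: xN.
  + exact: iS.
- by rewrite cS.
- by rewrite cardsU1 !inE (negbTE xS) andbF -cS (cardsD1 y S) yS.
apply/existsP; exists y; apply/existsP; exists x.
rewrite yS xS !inE eqxx (negbTE yx) frust_sym xy /=.
by rewrite eqxx setUC eqxx.
Qed.

Lemma ts_chargeE s S0 :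
  ts_charge V b s S0 = \sum_(S in ts_family s S0) hmono h S.
Proof. by apply: eq_big => [S|S _]; rewrite ?inE ?hprodE. Qed.

Definition hole_family_of (C0 : {set pauli_string n}) :=
  [set Cy | connect (deform V b) C0 Cy].

Lemma deform_even_hole Cy Cy' : deform V b Cy Cy' -> even_hole V b Cy'.
Proof.
case/andP=> /even_holeP[AV [N [g cA]]] /existsP[j /existsP[k]].
case/and5P=> jV jC kC /eqP nbj /eqP->; apply/even_holeP; split.
  by rewrite subUset sub1set jV (subset_trans _ AV) ?subD1set.
exists N; eexists; exact: (ce_move frust_sym frust_irr cA jC kC nbj).
Qed.

Lemma hole_familyP C0 A : even_hole V b C0 -> A \in hole_family_of C0 -> even_hole V b A.
Proof.
rewrite inE => hC0 /connectP[p]; elim: p C0 hC0 => [|C1 p IHp] C0 hC0 /=; first by move=> _ ->.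
by move=> /andP[/deform_even_hole]; apply: IHp.
Qed.

(** [hole_colour] picks some colouring; by [colouring_hmono] all of them give the same product. *)
Lemma hhole_colouring A X : even_hole V b A -> colouring adj A X ->
  hhole V b A = hmono h X * hmono h (A :\: X).
Proof.
move=> /even_holeP[AV [N [g cA]]] cX; rewrite /hhole /hole_colour.
case: pickP => [Y /and3P[YA /indepP[_ iY] /indepP[_ iY']]|/(_ X)].
  rewrite !hprodE mulmxE; apply: (colouring_hmono frust_sym hterm_sign cA AV cX).
  by split.
case: cX => XA iX iY; rewrite XA /=.
have -> : indep V b X by apply/indepP; split=> //; apply: subset_trans AV.
have -> // : indep V b (A :\: X).
by apply/indepP; split=> //; apply: subset_trans AV; apply: subsetDl.
Qed.

(** The move asked for by [hole_family] is a single-vertex deformation. *)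
Lemma cycle_sym_family C0 : even_hole V b C0 ->
  charge_family adj V h (hole_family_of C0) (hhole V b).
Proof.
move=> hC0; have holeF A := @hole_familyP C0 A hC0; apply: hole_family.
- exact: frust_sym.
- exact: frust_irr.
- exact: hterm_sign.
- exact: frust_claw.
- by move=> A /holeF/even_holeP.
- by move=> A X /holeF; apply: hhole_colouring.
move=> A x y AF xV xA yA nbx; have hA := holeF A AF.
move: AF; rewrite !inE => AF; apply: connect_trans AF (connect1 _).
rewrite /deform hA; apply/existsP; exists x; apply/existsP; exists y.
by rewrite xV xA yA eqxx andbT; apply/eqP.
Qed.

Lemma cycle_symE C0 :
  cycle_sym V b C0 = \sum_(A in hole_family_of C0) hhole V b A.
Proof. by apply: eq_bigl => A; rewrite inE. Qed.

End ClawFree.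
End Assembly.

Theorem theorem1 (C : numClosedFieldType) (n : nat)
    (V : {set pauli_string n}) (b : pauli_string n -> C) :
  (forall j, j \in V -> (b j \is Num.real) && (b j != 0)) ->
  claw_free V b ->
  (* (i) *)
  (forall (s t : nat) (S0 T0 : {set pauli_string n}),
      indep V b S0 -> #|S0| = s -> indep V b T0 -> #|T0| = t ->
      mx_commute (ts_charge V b s S0) (ts_charge V b t T0)) /\
  (* (ii) *)
  (forall (C0 : {set pauli_string n}) (s : nat) (S0 : {set pauli_string n}),
      even_hole V b C0 -> indep V b S0 -> #|S0| = s ->
      mx_commute (cycle_sym V b C0) (ts_charge V b s S0)) /\
  (* (iii) *)
  (forall C0 C0' : {set pauli_string n},
      even_hole V b C0 -> even_hole V b C0' ->
      mx_commute (cycle_sym V b C0) (cycle_sym V b C0')) /\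
  (* conserved charges of H *)
  (forall (s : nat) (S0 : {set pauli_string n}),
      indep V b S0 -> #|S0| = s -> mx_commute (Ham V b) (ts_charge V b s S0)) /\
  (forall C0 : {set pauli_string n},
      even_hole V b C0 -> mx_commute (Ham V b) (cycle_sym V b C0)).
Proof.
move=> bV claw; have b0 j : j \in V -> b j != 0 by case/bV/andP.
have sym := frust_sym V b; have irr := frust_irr b0; have hs := @hterm_sign C n V b.
have reg := @hterm_reg C n V b b0; have two := @mx_two_reg C n.
have famQ s S0 (iS : indep V b S0) (cS : #|S0| = s) := ts_charge_family b0 claw iS cS.
have famJ C0 (hC : even_hole V b C0) := cycle_sym_family b0 claw hC.
have commE (x y : 'M[C]_(2 ^ n)) : comm x y = 0 -> mx_commute x y by move/subr0_eq.
split; [|split; [|split; [|split]]].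
- move=> s t S0 T0 iS cS iT cT; rewrite !ts_chargeE; apply: commE.
  apply: (comm_indep sym irr hs reg two (famQ _ _ iS cS) (famQ _ _ iT cT)).
  by move=> B /(ts_familyP iT cT)[].
- move=> C0 s S0 hC iS cS; rewrite ts_chargeE cycle_symE; apply: commE.
  apply: (comm_indep sym irr hs reg two (famJ _ hC) (famQ _ _ iS cS)).
  by move=> B /(ts_familyP iS cS)[].
- move=> C0 C0' hC hC'; rewrite !cycle_symE; apply: commE.
  apply: (comm_holes sym irr hs reg two (famJ _ hC) (famJ _ hC')).
    by move=> A /(hole_familyP b0 hC)/even_holeP[].
  by move=> A /(hole_familyP b0 hC')/even_holeP[].
- move=> s S0 iS cS; rewrite ts_chargeE; apply/esym/commE.
  exact: (comm_hamiltonian sym irr hs two (famQ _ _ iS cS)).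
- move=> C0 hC; rewrite cycle_symE; apply/esym/commE.
  exact: (comm_hamiltonian sym irr hs two (famJ _ hC)).
Qed.
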